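(* Let $p_1(n)$ be the number of partitions of $n$ wherein odd parts appear without gaps, the only even part is one plus the largest odd part (if it appears at all), weighted by $-1$ raised to the number of odd parts which appear more than once plus the number of appearances of the even part. Then $$\sum_{n\ge1}p_1(n)z^n=O\left(\frac{1}{1-z}\right),$$ and $$\sum_{\substack{n\ge 1\\ p_1(n)>0}} z^n=O\left(\frac{1}{(1-z)\sqrt{\log\left(\frac{1}{1-z}\right)}}\right),$$ as $z\rightarrow1$.
   Context: A partition of $n$ is a finite multiset of positive integers (the parts) with sum $n$. ''Odd parts appear without gaps'' means that the odd numbers occurring as parts are exactly $1,3,\dots,2m-1$ for some integer $m\ge1$, each occurring at least once; the only even number that may occur is then $2m$, any number of times or not at all. ''Weighted by'' means that $p_1(n)$ is the sum of the stated signs over all such partitions of $n$. The variable $z$ is real and tends to $1$ from below. The notation $f(z)=O(g(z))$ means $|f(z)|\le K g(z)$ for a positive constant $K$ (here, for $z$ close enough to $1$). The second sum runs over those $n\ge1$ for which $p_1(n)$ is strictly positive.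
   Formalization: ''The number of odd parts which appear more than once'' is taken as the number of repeated appearances of odd parts (an odd part appearing j times counts j-1); counting distinct repeated odd parts instead leaves about half of all p_1(n) positive numerically, against the second bound. *)

(* Defs.v *)
From HB Require Import structures.
From mathcomp Require Import all_boot all_order all_algebra.
From mathcomp Require Import all_classical all_reals all_analysis.
Set Implicit Arguments.
Unset Strict Implicit.
Unset Printing Implicit Defensive.
Import Order.TTheory GRing.Theory Num.Theory.
Import numFieldNormedType.Exports.

(* Candidate multisets of parts for the partitions of n: [mu k] is the number
   of times k occurs. Neither a part nor a multiplicity of a partition of n
   can exceed n. *)
Definition multiplicities (n : nat) := {ffun 'I_n.+1 -> 'I_n.+1}.

(* The multiplicity of an arbitrary natural number, 0 beyond n. *)
Definition mult (n : nat) (mu : multiplicities n) (k : nat) : nat :=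
  if insub k is Some i then mu i else 0.

Definition is_partition (n : nat) (mu : multiplicities n) : bool :=
  (mult mu 0 == 0) && (\sum_(k < n.+1) mult mu k * k == n).

Definition odd_parts_without_gaps (a : nat -> nat) (m : nat) : Prop :=
  forall k, odd k -> (0 < a k) = (k <= m.*2.-1).

(* With 2m-1 the largest odd part, 2m is the only even part allowed. *)
Definition admissible (a : nat -> nat) : Prop :=
  exists m, [/\ 0 < m, odd_parts_without_gaps a m &
    forall k, ~~ odd k -> 0 < a k -> k = m.*2].

(* Odd parts are counted as members of the multiset: an odd part occurring
   j >= 1 times contributes its j - 1 repeated occurrences. An absent one
   contributes 0, as 0.-1 = 0. *)
Definition odd_repetitions (n : nat) (mu : multiplicities n) : nat :=
  \sum_(k < n.+1 | odd k) (mult mu k).-1.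

(* When mu is admissible, only its even part 2m contributes. *)
Definition even_appearances (n : nat) (mu : multiplicities n) : nat :=
  \sum_(k < n.+1 | ~~ odd k) mult mu k.

Definition p1 (n : nat) : int :=
  (\sum_(mu : multiplicities n | is_partition mu && `[< admissible (mult mu) >])
    (-1) ^+ (odd_repetitions mu + even_appearances mu))%R.

(* Main.v *)
Require Import Defs.
From HB Require Import structures.
From mathcomp Require Import all_boot all_order all_algebra.
From mathcomp Require Import all_classical all_reals all_analysis.
From mathcomp Require Import ring lra zify.
Set Implicit Arguments.
Unset Strict Implicit.
Unset Printing Implicit Defensive.
Import Order.TTheory GRing.Theory Num.Theory.
Import numFieldNormedType.Exports.
Local Open Scope classical_set_scope.
Local Open Scope ring_scope.

(* With m the index of the largest odd part 2m - 1, the generating function is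
   sum_(m >= 1) q^(m^2) / (prod_(i <= m) (1 + q^(2i-1)) * (1 + q^(2m))).
   A Bailey pair relative to a = 1 in base Q = q^2, summed with q-Saalschuetz
   weights, turns it into the Hecke-type double sum of (-1)^v q^(u^2 - 2v^2)
   over u >= 1 and -u/2 < v <= u/2. Counting its lattice points gives
   sum_(n <= x) |p1 n| <= 2x, hence the first bound.
   For the second one, p1 n <> 0 forces n to be a norm from Z[sqrt 2], so that
   n = 2^e g^2 s with all prime factors of s equal to 1 or 7 mod 8. Writing
   H(x) for the sum of 1/s over such s <= x, the square of H(x) is at most the
   sum of r(n)/n over n <= x^2, with r(n) the sum of the character (2/d) over
   d | n, whence H(x)^2 <= 1 + 2 ln x. Chebyshev's bound on psi turns this into
   O(x / sqrt(ln x)) such norms up to x. *)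

(** * A finite form of the Hecke-type identity *)

(** The transformation is proved at a finite level N, as an identity of rational functions in q, so
    that no infinite product and no rearrangement of series occurs; each sum is evaluated by
    telescoping with an explicit certificate that [field] checks. Truncation leaves weights that
    tend to 1 X-adically, and for a single coefficient some finite N is already enough. The saving
    of sqrt(ln x) comes from H(x), which is only of order sqrt(ln x) instead of ln x. It is carried
    over to the norms by weighting them with ln n: writing ln as the divisor sum of the von Mangoldt
    function bounds the weighted count by a multiple of x H(x). As ln n is close to ln x for most n
    <= x, division by ln x gives x / sqrt(ln x). *)

Section Identity.
Variables (F : fieldType) (q : F).
Hypothesis q_nz : q != 0.
Hypothesis q_nroot : forall k, (0 < k)%N -> 1 - q ^+ k != 0.

Definition poch (a b : F) (n : nat) : F := \prod_(i < n) (1 - a * b ^+ i).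

Lemma poch0 a b : poch a b 0 = 1. Proof. exact: big_ord0. Qed.

Lemma pochS a b n : poch a b n.+1 = poch a b n * (1 - a * b ^+ n).
Proof. exact: big_ord_recr. Qed.

Local Notation Q := (q ^+ 2).

Lemma q_nrootN k : (0 < k)%N -> 1 + q ^+ k != 0.
Proof.
move=> k0; have: 1 - q ^+ (k * 2) != 0 by rewrite q_nroot ?muln_gt0 ?k0.
apply: contraNneq => h; rewrite exprM.
have -> : 1 - (q ^+ k) ^+ 2 = (1 - q ^+ k) * (1 + q ^+ k) by ring.
by rewrite h mulr0.
Qed.

Lemma pochQ_nz n : poch Q Q n != 0.
Proof.
apply/prodf_neq0 => i _; rewrite -exprS -exprM q_nroot //.
Qed.

Lemma pochq_nz n : poch q Q n != 0.
Proof.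
apply/prodf_neq0 => i _; rewrite -exprM -exprS q_nroot //.
Qed.

Definition iqp n := (poch Q Q n)^-1.

Lemma iqpS n : iqp n = (1 - Q ^+ n.+1) * iqp n.+1.
Proof.
rewrite /iqp pochS -exprS invfM mulrCA mulfV ?mulr1 //.
by rewrite -exprM q_nroot.
Qed.

(* [1 / (Q; Q)_(m - k)], with the usual value 0 at negative indices, so that the
   recurrences below hold without side conditions. *)
Definition rqs m k := if (k <= m)%N then iqp (m - k) else 0.

Lemma rqsSS m k : rqs m.+1 k.+1 = rqs m k.
Proof. by rewrite /rqs ltnS subSS. Qed.

Lemma rqsSr m k : rqs m k.+1 = (1 - Q ^+ m / Q ^+ k) * rqs m k.
Proof.
rewrite /rqs; case: (ltngtP k m) => [km|mk|->].
- rewrite [iqp (m - k.+1)]iqpS subnSK // exprB ?unitfE ?expf_neq0 //; last exact: ltnW.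
- by rewrite mulr0.
- by rewrite divff ?expf_neq0 // subrr mul0r.
Qed.

Lemma rqsSl m k : rqs m k = (1 - Q ^+ m.+1 / Q ^+ k) * rqs m.+1 k.
Proof. by rewrite -rqsSS rqsSr. Qed.

Lemma rqsn0 m : rqs m 0 = iqp m.
Proof. by rewrite /rqs subn0. Qed.

Lemma rqsnn m : rqs m m = 1.
Proof. by rewrite /rqs leqnn subnn /iqp poch0 invr1. Qed.

Lemma rqs_out m k : (m < k)%N -> rqs m k = 0.
Proof. by move=> mk; rewrite /rqs leqNgt mk. Qed.

(** This is the sum over u that remains when, in a double sum over w <= u, the sum over w is taken
    outside. It telescopes, and the boundary term at n vanishes because m <= n. *)
Lemma bailey_tail_sum m w n : (0 < m <= n)%N -> (w <= n)%N ->
  \sum_(w <= u < n) q ^+ (u * u.+1) * (1 - Q ^+ u.+1) * rqs m u.+1 * iqp (m + u.+1)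
  = q ^+ (w * w.+1) * rqs m w.+1 * iqp (m + w) / (1 + Q ^+ m).
Proof.
case/andP=> m0 mn wn.
pose f w := - (q ^+ (w * w.+1) * rqs m w.+1 * iqp (m + w) / (1 + Q ^+ m)).
rewrite (eq_big_nat _ _ (F2 := fun u => f u.+1 - f u)); last first.
  move=> u _; rewrite /f.
  rewrite [rqs m u.+2]rqsSr [iqp (m + u)]iqpS addnS.
  have -> : (u.+1 * u.+2 = u * u.+1 + 2 * u.+1)%N by lia.
  rewrite exprD [q ^+ (2 * _)]exprM -addnS exprD.
  have qu : Q ^+ u.+1 != 0 by rewrite !expf_neq0.
  have : 1 + Q ^+ m != 0 by rewrite -exprM q_nrootN ?muln_gt0.
  by move: (Q ^+ m) (Q ^+ u.+1) qu => a b b0 a1; field; rewrite a1 b0.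
rewrite telescope_sumr // /f (@rqs_out m n.+1) ?ltnS //.
by rewrite mulr0 !mul0r oppr0 sub0r opprK.
Qed.

(* A Wilf-Zeilberger proof: after division by the right-hand side, the difference
   of the summands at [m.+1] and [m] is [g j.+1 - g j]. *)
Lemma half_range_sum m n : (m <= n.*2)%N ->
  iqp m ^+ 2 + \sum_(1 <= k < n.+1) (-1) ^+ k * q ^+ (2 * k ^ 2) *
     (Q ^+ k + (Q ^+ k)^-1) * rqs m k.*2 * iqp (m + k.*2)
  = q ^+ (m * m.-1) / (poch Q Q m * poch q Q m * poch (- q) Q m).
Proof.
elim: m n => [|m IHm] n mn.
  rewrite big1_seq ?addr0; last first.
    move=> k; rewrite mem_index_iota => /andP[_ /andP[k0 _]].
    by rewrite rqs_out ?double_gt0 // mulr0 mul0r.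
  by rewrite /iqp !poch0 !mulr1 invr1 expr1n mulr1 mul0n expr0.
(* Reciprocal of the right-hand side: the claim becomes that [M m] times the left-hand side is 1. *)
pose M m := poch Q Q m * poch q Q m * poch (- q) Q m / q ^+ (m * m.-1).
have Mnz i : M i != 0.
  rewrite /M !mulf_neq0 ?invr_eq0 ?expf_neq0 ?pochQ_nz ?pochq_nz //.
  apply/prodf_neq0 => j _; rewrite mulNr opprK -exprM -exprS q_nrootN //.
pose e m k := (-1) ^+ k * q ^+ (2 * k ^ 2) *
     (Q ^+ k + (Q ^+ k)^-1) * rqs m k.*2 * iqp (m + k.*2).
pose g j := (-1) ^+ j * q ^+ (2 * (j * j.+1)) / Q ^+ m * rqs m.+1 j.+1.*2
     * iqp (m + j.*2.+1) * M m.
have ME i : q ^+ (i * i.-1) / (poch Q Q i * poch q Q i * poch (- q) Q i) = (M i)^-1.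
  by rewrite /M invf_div.
have MS : M m.+1 = M m * (1 - Q * Q ^+ m) * (1 - Q * (Q ^+ m) ^+ 2) / Q ^+ m.
  rewrite /M !pochS.
  have -> : (m.+1 * m.+1.-1 = m * m.-1 + 2 * m)%N by case: (m) => [|i] /=; lia.
  rewrite exprD [q ^+ (2 * m)]exprM.
  have q1 : q ^+ (m * m.-1) != 0 by rewrite expf_neq0.
  have q2 : Q ^+ m != 0 by rewrite !expf_neq0.
  by move: (q ^+ (m * _)) q1 (Q ^+ m) q2 => a a0 b b0; field; rewrite a0 b0.
have q2 : Q ^+ m != 0 by rewrite !expf_neq0.
(* The index 0 has no partner -k, so its term is half of [e] at 0 and gets its own identity. *)
have g0 : M m.+1 * iqp m.+1 ^+ 2 - M m * iqp m ^+ 2 = g 0.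
  rewrite /g MS expr0 mul0n muln0 expr0 !mul1r [iqp m]iqpS rqsSS rqsSr rqsn0.
  rewrite [iqp m]iqpS [Q ^+ m.+1]exprS expr0 addn1.
  by rewrite divr1; move: (Q ^+ m) q2 => a a0; field.
have gS j : M m.+1 * e m.+1 j.+1 - M m * e m j.+1 = g j.+1 - g j.
  rewrite /g /e MS.
  have -> : rqs m j.+1.*2 = (1 - Q ^+ m.+1 / Q ^+ j.+1.*2) * rqs m.+1 j.+1.*2.
    exact: rqsSl.
  have -> : rqs m.+1 j.+2.*2 = (1 - Q ^+ m.+1 / Q ^+ j.+1.*2.+1) *
      (1 - Q ^+ m.+1 / Q ^+ j.+1.*2) * rqs m.+1 j.+1.*2.
    by rewrite -mulrA -!rqsSr.
  have -> : iqp (m + j.+1.*2) = (1 - Q ^+ (m + j.+1.*2).+1) * iqp (m.+1 + j.+1.*2).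
    by rewrite iqpS.
  have -> : iqp (m + j.*2.+1) = (1 - Q ^+ (m + j.+1.*2)) *
     (1 - Q ^+ (m + j.+1.*2).+1) * iqp (m.+1 + j.+1.*2).
    by rewrite -mulrA addSn -iqpS doubleS !addnS -iqpS.
  rewrite addnS -addSn.
  have -> : q ^+ (2 * j.+1 ^ 2) = q ^+ (2 * (j * j.+1)) * Q ^+ j.+1.
    by rewrite -exprM -exprD; congr (_ ^+ _); lia.
  have -> : q ^+ (2 * (j.+1 * j.+2)) = q ^+ (2 * (j * j.+1)) * Q ^+ j.+1 ^+ 2.
    by rewrite -!exprM -exprD; congr (_ ^+ _); lia.
  rewrite -[j.+1.*2]mul2n [(-1) ^+ j.+1]exprS [Q ^+ (2 * _).+1]exprS !exprD.
  rewrite ![Q ^+ (2 * _)]exprM [Q ^+ m.+1]exprS -![Q ^+ 2 ^+ _]exprM.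
  rewrite ![(2 * j.+1)%N]mulnC ![Q ^+ (j.+1 * 2)]exprM.
  have qj : Q ^+ j.+1 != 0 by rewrite !expf_neq0.
  move: (Q ^+ m) q2 (Q ^+ j.+1) qj => a a0 b b0.
  by field; rewrite a0 b0.
have gn : g n = 0.
  by rewrite /g rqs_out ?mulr0 ?mul0r //; lia.
rewrite ME; apply: (mulfI (Mnz m.+1)); rewrite [RHS]mulfV //.
have /(congr1 ( *%R (M m))) := IHm n ltac:(lia).
rewrite ME mulfV // => IH; apply: etrans IH; apply/eqP; rewrite -subr_eq0; apply/eqP.
rewrite !big_add1 /= !big_mkord !mulrDr !mulr_sumr opprD addrACA g0 -sumrB.
rewrite (eq_bigr (fun j : 'I_n => g j.+1 - g j)) => [|j _]; last exact: gS.
by rewrite -(big_mkord xpredT (fun j => g j.+1 - g j)) telescope_sumr // gn sub0r subrr.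
Qed.

(* The factors [q ^+ m * poch Q Q m.-1 * poch q Q m] are those of the q-Gauss
   sum; the two factors in [N - m] make it a terminating q-Saalschuetz sum. *)
Definition saal u N j := q ^+ j.+1 * poch Q Q j * poch q Q j.+1 *
  rqs j.+1 u * iqp (j.+1 + u) * poch q Q (N - j.+1) * rqs N j.+1.

(** Creative telescoping in u: at u = N only the summand j = N - 1 survives, and a first-order
    recurrence leads down from there. *)
Lemma saalschutz u N : (0 < u <= N)%N ->
  \sum_(j < N) saal u N j =
  q ^+ u / (1 - Q ^+ u) * poch Q Q N * poch q Q N * rqs N u * iqp (N + u).
Proof.
case/andP=> u0 uN; rewrite -(subKn uN).
have: (N - u < N)%N by lia.
elim: (N - u)%N => [_|d IHd dN].
  have pN : (N.-1 < N)%N by lia.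
  rewrite subn0 (bigD1 (Ordinal pN)) //= big1 ?addr0 => [|i iN]; last first.
    rewrite /saal rqs_out ?mulr0 ?mul0r //.
    have := ltn_ord i; move: iN; rewrite -val_eqE /=; lia.
  have -> : N = N.-1.+1 by lia.
  rewrite /saal /= subnn poch0 rqsnn !mulr1 [poch Q Q N.-1.+1]pochS -exprS.
  have := q_nroot (k := (2 * N.-1.+1)); rewrite exprM => /(_ isT) h.
  by move: (iqp _) (poch q Q _) (q ^+ _) => x y z; field.
have := IHd (ltnW dN).
have -> : (N - d = (N - d.+1).+1)%N by lia.
have : (0 < N - d.+1 < N)%N by lia.
move: (N - d.+1)%N => {u u0 uN IHd dN d} u /andP[u0 uN] IHu.
(* Certificate of the recurrence between u and u + 1. It vanishes at j = N through [rqs N N.+1] and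
   at j = 0 through [rqs 1 u.+1], as u > 0. *)
pose g j := - (1 + q * Q ^+ u) / q * q ^+ j.+1 * poch Q Q j * poch q Q j.+1 *
   rqs j.+1 u.+1 * iqp (j.+1 + u) * poch q Q (N.+1 - j.+1) * rqs N j.+1.
have gS j : (j < N)%N ->
    (1 - Q ^+ u.+1) * (1 - Q ^+ (N + u.+1)) / q * saal u.+1 N j
    - (1 - Q ^+ u) * (1 - Q ^+ N / Q ^+ u) * saal u N j = g j.+1 - g j.
  move=> jN; rewrite /g /saal.
  rewrite [poch Q Q j.+1]pochS [poch q Q j.+2]pochS [rqs j.+2 _]rqsSS.
  rewrite [rqs j.+1 u.+1]rqsSr [rqs N j.+2]rqsSr subSS [(N.+1 - _)%N]subSn //.
  rewrite [poch q Q (N - j.+1).+1]pochS [Q ^+ (N - _)]exprB ?unitfE ?expf_neq0 //.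
  rewrite [iqp (j.+1 + u)]iqpS -addnS [(j.+2 + u)%N]addSnnS -!exprS.
  rewrite ![Q ^+ (_ + _)]exprD ![Q ^+ u.+1]exprS [q ^+ j.+2]exprS.
  have qj : Q ^+ j.+1 != 0 by rewrite !expf_neq0.
  have qu : Q ^+ u != 0 by rewrite !expf_neq0.
  move: (q ^+ j.+1) (Q ^+ j.+1) qj (Q ^+ u) qu (Q ^+ N) => x a a0 b b0 n.
  move: (rqs _ _) (rqs _ _) (iqp _) (poch _ _ _) (poch _ _ _) (poch _ _ _).
  move=> t1 t2 t3 t4 t5 t6.
  by field; rewrite a0 b0.
have c1 : 1 - Q ^+ u.+1 != 0 by rewrite -exprM q_nroot.
have c2 : 1 - Q ^+ u != 0 by rewrite -exprM q_nroot ?muln_gt0.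
have c3 : 1 - Q ^+ N / Q ^+ u != 0.
  rewrite -exprB ?unitfE ?expf_neq0 //; last exact: ltnW.
  by rewrite -exprM q_nroot // muln_gt0 subn_gt0.
have: (1 - Q ^+ u.+1) * (1 - Q ^+ (N + u.+1)) / q * (\sum_(j < N) saal u.+1 N j)
    - (1 - Q ^+ u) * (1 - Q ^+ N / Q ^+ u) * (\sum_(j < N) saal u N j) = 0.
  rewrite !mulr_sumr -sumrB (eq_bigr (fun j : 'I_N => g j.+1 - g j)); last first.
    by move=> j _; apply: gS.
  rewrite -(big_mkord xpredT (fun j => g j.+1 - g j)) telescope_sumr // /g.
  by rewrite (@rqs_out N) // (@rqs_out 1) // !mulr0 !mul0r subrr.
rewrite IHu => /eqP; rewrite subr_eq0 => /eqP IH.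
apply: (mulfI (mulf_neq0 c2 c3)); rewrite -IH rqsSr [iqp (N + u)]iqpS -addnS.
rewrite [q ^+ u.+1]exprS; move: c1 c2 (1 - Q ^+ N / _) (1 - Q ^+ (N + _)).
move: (1 - Q ^+ u.+1) (1 - Q ^+ u) => a b a0 b0 c d.
by field; rewrite ?a0 ?b0.
Qed.

(* The indices v = 0, 1, -1, 2, -2, ... in this order have |v| = uphalf w, and
   w < u exactly when -u/2 < v <= u/2. *)
Definition hecke_coeff w : F := (-1) ^+ uphalf w / q ^+ (2 * uphalf w ^ 2).

(** The bracket is the tail sum starting at w, up to the factor 1 + Q^m. The tails at w = 2k - 1 and
    w = 2k carry the same coefficient and add up to 1 - Q^m times the terms k and -k of the
    half-range sum. *)
Lemma half_range_pairs m K :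
  \sum_(w < K.*2.+1) hecke_coeff w * (q ^+ (w * w.+1) * rqs m w.+1 * iqp (m + w)) =
  (1 - Q ^+ m) * (iqp m ^+ 2 + \sum_(1 <= k < K.+1) (-1) ^+ k * q ^+ (2 * k ^ 2) *
     (Q ^+ k + (Q ^+ k)^-1) * rqs m k.*2 * iqp (m + k.*2)).
Proof.
elim: K => [|K IH].
  rewrite big_ord1 big_geq // /hecke_coeff !expr0 rqsSr rqsn0 addn0 addr0 !expr0 !divr1.
  by rewrite !mul1r -mulrA expr2.
rewrite doubleS 2!big_ord_recr IH /= [in RHS]big_nat_recr //= -addrA [in RHS]addrA.
rewrite [RHS]mulrDr; congr (_ + _).
have u1 : uphalf K.*2.+1 = K.+1 by rewrite /= doubleK.
have u2 : uphalf K.*2.+2 = K.+1 by rewrite /= uphalf_double.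
rewrite /hecke_coeff u1 u2 -!doubleS [rqs m K.+1.*2.+1]rqsSr.
rewrite addnS [iqp (m + K.*2).+1]iqpS -!addnS -doubleS.
have -> : (K.*2.+1 * K.+1.*2 = 2 * K.+1 ^ 2 + 2 * K.+1 ^ 2 - 2 * K.+1)%N by lia.
have -> : (K.+1.*2 * K.+1.*2.+1 = 2 * K.+1 ^ 2 + 2 * K.+1 ^ 2 + 2 * K.+1)%N by lia.
rewrite exprB ?unitfE //; last by nia.
rewrite !exprD -muln2 ![Q ^+ (_ * 2)]exprM [q ^+ (2 * K.+1)]exprM.
have q1 : Q ^+ K.+1 != 0 by rewrite !expf_neq0.
have q2 : q ^+ (2 * K.+1 ^ 2) != 0 by rewrite expf_neq0.
move: (q ^+ _) q2 (Q ^+ K.+1) q1 (Q ^+ m) => a a0 b b0 c.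
by field; rewrite a0 b0.
Qed.

Lemma half_range m n : (0 < m <= n)%N ->
  \sum_(w < n) hecke_coeff w * (q ^+ (w * w.+1) * rqs m w.+1 * iqp (m + w)) =
  (1 - Q ^+ m) * (q ^+ (m * m.-1) / (poch Q Q m * poch q Q m * poch (- q) Q m)).
Proof.
case/andP=> m0 mn; rewrite -(@half_range_sum m m) -?half_range_pairs; last lia.
pose f w := hecke_coeff w * (q ^+ (w * w.+1) * rqs m w.+1 * iqp (m + w)).
(* Terms with w >= m vanish, so the upper limits n and 2m + 1 can both be lowered to m. *)
suff H k : (m <= k)%N -> \sum_(w < k) f w = \sum_(w < m) f w.
  by rewrite [LHS]H // [RHS]H //; lia.
move=> mk; rewrite -!(big_mkord xpredT f) (big_cat_nat (leq0n m) mk) //= [X in _ + X]big1_seq ?addr0 //.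
move=> w; rewrite mem_index_iota => /andP[_ /andP[mw _]].
by rewrite /f rqs_out ?ltnS // mulr0 mul0r mulr0.
Qed.

(** With U = u + 1, the product of [rqs] and [iqp] is the Bailey kernel 1 / ((Q;Q)_(m-U)
    (Q;Q)_(m+U)), and alpha_U is q^(U(U-1)) (1 - Q^U) times the sum of [hecke_coeff]; alpha_0 = 0.
    Exchanging the sums over u and w produces the tail sums. *)
Lemma bailey_pair m n : (0 < m <= n)%N ->
  \sum_(u < n) q ^+ (u * u.+1) * (1 - Q ^+ u.+1) * rqs m u.+1 * iqp (m + u.+1)
     * (\sum_(w < u.+1) hecke_coeff w)
  = (1 - Q ^+ m) / (1 + Q ^+ m) *
    (q ^+ (m * m.-1) / (poch Q Q m * poch q Q m * poch (- q) Q m)).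
Proof.
move=> mn; rewrite mulrAC -(half_range mn) mulr_suml.
pose h u := q ^+ (u * u.+1) * (1 - Q ^+ u.+1) * rqs m u.+1 * iqp (m + u.+1).
under eq_bigr => u _ do rewrite (big_ord_widen n hecke_coeff (ltn_ord u)) mulr_sumr.
rewrite (exchange_big_dep xpredT) //=; apply: eq_bigr => w _.
rewrite -mulr_suml mulrC -[RHS]mulrA; congr (_ * _).
rewrite -(@bailey_tail_sum m w n) //; last exact: ltnW.
rewrite (big_nat_widenl w 0) // (big_mkord _ h).
by apply: eq_bigl. Qed.

(** Bailey's lemma: the weight of u is expanded by [saalschutz], the sums are exchanged, and
    [bailey_pair] evaluates the inner one. The last factor on each side is the effect of truncation
    at N. *)
Lemma hecke_finite N :
  \sum_(u < N) q ^+ (u.+1 ^ 2) * (\sum_(w < u.+1) hecke_coeff w) *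
     (poch Q Q N ^+ 2 * rqs N u.+1 * iqp (N + u.+1)) =
  \sum_(m < N) q ^+ (m.+1 ^ 2) / (poch (- q) Q m.+1 * (1 + Q ^+ m.+1)) *
     (poch q Q (N - m.+1) * poch Q Q N * rqs N m.+1 / poch q Q N).
Proof.
have E (u : 'I_N) : q ^+ (u.+1 ^ 2) * (\sum_(w < u.+1) hecke_coeff w) *
     (poch Q Q N ^+ 2 * rqs N u.+1 * iqp (N + u.+1)) =
   \sum_(m < N) (q ^+ m.+1 * poch Q Q m * poch q Q m.+1 * poch q Q (N - m.+1)
      * rqs N m.+1 * poch Q Q N / poch q Q N) *
     (q ^+ (u * u.+1) * (1 - Q ^+ u.+1) * rqs m.+1 u.+1 * iqp (m.+1 + u.+1)
     * (\sum_(w < u.+1) hecke_coeff w)).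
  have := @saalschutz u.+1 N; rewrite ltn_ord => /(_ isT) S.
  transitivity (q ^+ (u * u.+1) * (1 - Q ^+ u.+1) * (\sum_(w < u.+1) hecke_coeff w) *
    poch Q Q N / poch q Q N * \sum_(j < N) saal u.+1 N j); last first.
    rewrite mulr_sumr; apply: eq_bigr => m _; rewrite /saal.
    by ring.
  rewrite S.
  have -> : (u.+1 ^ 2 = u * u.+1 + u.+1)%N by lia.
  rewrite exprD; have := @pochq_nz N; have: 1 - Q ^+ u.+1 != 0 by rewrite -exprM q_nroot.
  move: (poch q Q N) (1 - _) => a b b0 a0.
  by field; rewrite a0 b0.
rewrite (eq_bigr _ (fun u _ => E u)) exchange_big; apply: eq_bigr => m _ /=.
rewrite -mulr_sumr bailey_pair; last by rewrite /= ltn_ord.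
rewrite [poch Q Q m.+1]pochS -exprS /=.
have -> : (m.+1 ^ 2 = m.+1 * m + m.+1)%N by lia.
have := @pochq_nz N; have := @pochq_nz m.+1; have := @pochQ_nz m.
have: 1 - Q ^+ m.+1 != 0 by rewrite -exprM q_nroot.
have: 1 + Q ^+ m.+1 != 0 by rewrite -exprM q_nrootN.
have : poch (- q) Q m.+1 != 0.
  apply/prodf_neq0 => j _; rewrite mulNr opprK -exprM -exprS q_nrootN //.
rewrite exprD; move: (poch (- q) _ _) (poch q Q m.+1) (poch q Q N) (poch Q Q m) (poch q Q _).
move: (1 + _) (1 - _) => a b c d e f g c0 a0 b0 f0 d0 e0.
by field; rewrite a0 b0 c0 d0 e0 f0.
Qed.
End Identity.

(** * The generating function as a formal power series *)

Local Notation "x %:F" := (tofrac x) : ring_scope.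

(* [f] is a power series divisible by X^k; the choice [b`_0 = 1] keeps it integral. *)
Definition small (k : nat) (f : {fraction {poly int}}) : Prop :=
  exists a b : {poly int}, b`_0 = 1 /\ f * b%:F = ('X^k * a)%:F.

Section Small.
Local Notation F := {fraction {poly int}}.
Implicit Types (k : nat) (f g : F) (p : {poly int}).

Lemma smallW j k f : (j <= k)%N -> small k f -> small j f.
Proof.
move=> jk [a [b [b0 E]]]; exists ('X^(k - j) * a), b; split=> //.
by rewrite E mulrA -exprD subnKC.
Qed.

Lemma smallD k f g : small k f -> small k g -> small k (f + g).
Proof.
move=> [a [b [b0 E]]] [c [d [d0 G]]]; exists (a * d + c * b), (b * d).
split; first by rewrite coef0M b0 d0 mulr1.
rewrite rmorphM mulrDl mulrA E [b%:F * _]mulrC mulrA G -!rmorphM -rmorphD.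
by congr (_%:F); ring.
Qed.

Lemma smallM j k f g : small j f -> small k g -> small (j + k) (f * g).
Proof.
move=> [a [b [b0 E]]] [c [d [d0 G]]]; exists (a * c), (b * d).
split; first by rewrite coef0M b0 d0 mulr1.
rewrite rmorphM mulrACA E G -rmorphM exprD; congr (_%:F); ring.
Qed.

Lemma smallMr k f g : small k f -> small 0 g -> small k (f * g).
Proof. by move=> hf hg; rewrite -[k]addn0; apply: smallM. Qed.

Lemma small0 k : small k 0.
Proof. by exists 0, 1; split; rewrite ?coef1 // mul0r mulr0 rmorph0. Qed.

Lemma small_poly k p : small k ('X^k * p)%:F.
Proof. by exists p, 1; split; rewrite ?coef1 // rmorph1 mulr1. Qed.

Lemma small_int p : small 0 p%:F.
Proof. by have := small_poly 0 p; rewrite expr0 mul1r. Qed.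

Lemma small1 : small 0 1.
Proof. by have := small_int 1; rewrite rmorph1. Qed.

Lemma smallN k f : small k f -> small k (- f).
Proof.
move=> hf; rewrite -mulrN1; apply: smallMr hf _.
by have := small_int (-1); rewrite rmorphN rmorph1.
Qed.

Lemma smallB k f g : small k f -> small k g -> small k (f - g).
Proof. by move=> hf hg; apply: smallD => //; apply: smallN. Qed.

Lemma small_sum I (r : seq I) (P : pred I) k (G : I -> F) :
  (forall i, P i -> small k (G i)) -> small k (\sum_(i <- r | P i) G i).
Proof. by move=> h; elim/big_ind: _ => //; [exact: small0 | exact: smallD]. Qed.

Lemma small_prod I (r : seq I) (P : pred I) (G : I -> F) :
  (forall i, P i -> small 0 (G i)) -> small 0 (\prod_(i <- r | P i) G i).
Proof. by move=> h; elim/big_ind: _ => //; [exact: small1 | exact: smallMr]. Qed.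

(** From here on [small k (f - g)] serves as congruence of f and g modulo X^k. *)
Lemma small_trans k f g h : small k (f - g) -> small k (g - h) -> small k (f - h).
Proof. by move=> x y; have := smallD x y; rewrite addrA subrK. Qed.

Lemma small_congM k f f' g g' : small 0 f -> small 0 g' ->
  small k (f - f') -> small k (g - g') -> small k (f * g - f' * g').
Proof.
move=> hf hg' h1 h2.
have -> : f * g - f' * g' = (g - g') * f + (f - f') * g' by ring.
by apply: smallD; apply: smallMr.
Qed.

Lemma small_cong_prod n k (G H : nat -> F) :
  (forall i, (i < n)%N -> small 0 (G i)) -> (forall i, (i < n)%N -> small 0 (H i)) ->
  (forall i, (i < n)%N -> small k (G i - H i)) ->
  small k (\prod_(i < n) G i - \prod_(i < n) H i).
Proof.
elim: n => [|n IH] hG hH hGH; first by rewrite !big_ord0 subrr; apply: small0.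
rewrite !big_ord_recr /=; apply: small_congM.
- by apply: small_prod => i _; apply: hG; rewrite ltnW // ltnS.
- exact: hH.
- by apply: IH => i ni; [apply: hG|apply: hH|apply: hGH]; apply: ltnW.
- exact: hGH.
Qed.

Lemma small_inv p : p`_0 = 1 -> small 0 (p%:F)^-1.
Proof.
move=> p0; exists 1, p; split=> //; rewrite mulr1 expr0 rmorph1 mulVf //.
rewrite tofrac_eq0; apply: contra_eq_neq p0 => ->.
by rewrite coef0 eq_sym oner_eq0.
Qed.

Lemma coef_small k p i : small k p%:F -> (i < k)%N -> p`_i = 0.
Proof.
move=> [a [b [b0]]]; rewrite -rmorphM => /eqP; rewrite tofrac_eq => /eqP E.
elim/ltn_ind: i => i IH ik.
have := congr1 (fun r : {poly int} => r`_i) E.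
rewrite coefXnM ik coefM big_ord_recr /= subnn b0 mulr1 big1 ?add0r // => j _.
by rewrite IH ?mul0r // (ltn_trans (ltn_ord j)).
Qed.

Definition qX : F := ('X)%:F.

Lemma small_qX k : small k (qX ^+ k).
Proof. by have := small_poly k 1; rewrite mulr1 rmorphXn. Qed.

Lemma qX_neq0 : qX != 0.
Proof. by rewrite tofrac_eq0 polyX_eq0. Qed.

Lemma qX_nroot k : (0 < k)%N -> 1 - qX ^+ k != 0.
Proof.
move=> k0; rewrite -rmorphXn -(rmorph1 (@tofrac {poly int})) -rmorphB tofrac_eq0.
apply/eqP => /(congr1 (fun p : {poly int} => p`_0)).
by rewrite coefB coef1 coefXn coef0 (ltn_eqF k0).
Qed.

Lemma small_invD k : (0 < k)%N -> small 0 (1 + qX ^+ k)^-1.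
Proof.
move=> k0; have -> : 1 + qX ^+ k = (1 + 'X^k)%:F by rewrite rmorphD rmorph1 rmorphXn.
by apply: small_inv; rewrite coefD coef1 coefXn (ltn_eqF k0).
Qed.

Lemma small_invB k : (0 < k)%N -> small 0 (1 - qX ^+ k)^-1.
Proof.
move=> k0; have -> : 1 - qX ^+ k = (1 - 'X^k)%:F by rewrite rmorphB rmorph1 rmorphXn.
by apply: small_inv; rewrite coefB coef1 coefXn (ltn_eqF k0).
Qed.

Lemma small_1D k : (0 < k)%N -> small k ((1 + qX ^+ k)^-1 - 1).
Proof.
move=> k0; have -> : (1 + qX ^+ k)^-1 - 1 = - (qX ^+ k * (1 + qX ^+ k)^-1).
  have := @q_nrootN F qX qX_nroot k k0; move: (qX ^+ k) => a a0.
  apply: (mulIf a0); rewrite mulrBl mulVf // mulNr -mulrA mulVf //.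
  by rewrite mulr1 mul1r opprD addrA subrr add0r.
by apply/smallN/smallMr; [apply: small_qX|apply: small_invD].
Qed.

Local Notation qQ := (qX ^+ 2).

Lemma small_pochV a n : a = qX \/ a = qQ -> small 0 (poch a qQ n)^-1.
Proof.
move=> ha; rewrite /poch -prodfV; apply: small_prod => i _.
by case: ha => ->; rewrite -exprM -?exprS -?exprD; apply: small_invB.
Qed.

Lemma small_poch a n : a = qX \/ a = qQ -> small 0 (poch a qQ n).
Proof.
move=> ha; apply: small_prod => i _; apply: smallB; first exact: small1.
by case: ha => ->; rewrite -exprM -?exprS -?exprD; apply: smallW (small_qX _).
Qed.

Lemma small_poch_diff a k m n : a = qX \/ a = qQ -> (k <= m <= n)%N ->
  small k (poch a qQ n - poch a qQ m).
Proof.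
move=> ha /andP[km mn]; elim: n mn => [|n IH] mn.
  by move: mn; rewrite leqn0 => /eqP ->; rewrite subrr; apply: small0.
have [->|nm] := eqVneq m n.+1; first by rewrite subrr; apply: small0.
have mn' : (m <= n)%N by lia.
rewrite pochS mulrBr mulr1 addrAC; apply: smallB; first exact: IH.
rewrite mulrC; apply: smallMr; last exact: small_poch.
by case: ha => ->; rewrite -exprM -?exprS -?exprD; apply: smallW (small_qX _); lia.
Qed.

Lemma poch_neq0 a n : a = qX \/ a = qQ -> poch a qQ n != 0.
Proof.
by case=> ->; [apply: pochq_nz | apply: pochQ_nz]; exact: qX_nroot.
Qed.

Lemma small_poch_ratio a k m n : a = qX \/ a = qQ -> (k <= m)%N -> (k <= n)%N ->
  small k (poch a qQ m / poch a qQ n - 1).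
Proof.
move=> ha km kn.
have -> : poch a qQ m / poch a qQ n - 1 = (poch a qQ m - poch a qQ n) / poch a qQ n.
  by rewrite mulrBl divff ?poch_neq0.
apply: smallMr; last exact: small_pochV.
case: (leqP n m) => mn; first by apply: small_poch_diff; rewrite ?kn.
by rewrite -opprB; apply/smallN/small_poch_diff; rewrite ?km // ltnW.
Qed.
End Small.

(** * The X-adic limit of the finite identity *)

Definition hecke_poly (u : nat) : {poly int} :=
  \sum_(w < u) (-1) ^+ uphalf w *: 'X^(u ^ 2 - 2 * uphalf w ^ 2).

Definition hecke (N : nat) : {poly int} := \sum_(u < N) hecke_poly u.+1.

Local Notation qQ := (qX ^+ 2).

Definition gf_term (m : nat) : {fraction {poly int}} :=
  qX ^+ (m ^ 2) / (poch (- qX) qQ m * (1 + qQ ^+ m)).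

(** Because 2|v| <= u. Hence the subtraction in [hecke_poly] never truncates, and its exponents are
    at least u^2 / 2. *)
Lemma uphalf_sqr_le u w : (w < u)%N -> (2 * (2 * uphalf w ^ 2) <= u ^ 2)%N.
Proof.
move=> wu; have h : (2 * uphalf w <= u)%N by lia.
have := leq_mul h h; lia.
Qed.

Lemma hecke_polyE u :
  (hecke_poly u)%:F = qX ^+ (u ^ 2) * (\sum_(w < u) hecke_coeff qX w).
Proof.
rewrite rmorph_sum mulr_sumr; apply: eq_bigr => w _.
have h := uphalf_sqr_le (ltn_ord w).
have h2 : (2 * uphalf w ^ 2 <= u ^ 2)%N by apply: leq_trans h; rewrite leq_pmull.
rewrite -mul_polyC rmorphM !rmorphXn !rmorphN !rmorph1 -/qX.
by rewrite exprB ?unitfE ?qX_neq0 // mulrCA.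
Qed.

Lemma small_hecke_poly n u : (n.+1.*2 <= u)%N -> small n.+1 (hecke_poly u)%:F.
Proof.
move=> nu; rewrite rmorph_sum; apply: small_sum => w _.
have h := uphalf_sqr_le (ltn_ord w).
have le : (n.+1 <= u ^ 2 - 2 * uphalf w ^ 2)%N.
  have := leq_mul nu nu; lia.
apply: smallW le _; rewrite -mul_polyC mulrC; exact: small_poly.
Qed.

Lemma hecke_weight n N u : (u + n <= N)%N ->
  small n (poch qQ qQ N ^+ 2 * rqs qX N u * iqp qX (N + u) - 1).
Proof.
move=> le; rewrite /rqs /iqp (leq_trans (leq_addr n u) le).
set p := poch qQ qQ.
have E : p N ^+ 2 / p (N - u)%N / p (N + u)%N - 1 =
    (p N / p (N - u)%N) * (p N / p (N + u)%N) - 1 * 1 by rewrite mulr1 expr2 mulrACA mulrA.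
rewrite E; apply: small_congM.
- by apply: smallMr; [apply: small_poch|apply: small_pochV]; right.
- exact: small1.
- by apply: small_poch_ratio; [right|lia|lia].
- by apply: small_poch_ratio; [right|lia|lia].
Qed.

Lemma gf_weight n N m : (m + n <= N)%N ->
  small n (poch qX qQ (N - m) * poch qQ qQ N * rqs qX N m / poch qX qQ N - 1).
Proof.
move=> le; rewrite /rqs /iqp (leq_trans (leq_addr n m) le).
have E : poch qX qQ (N - m) * poch qQ qQ N / poch qQ qQ (N - m) / poch qX qQ N - 1 =
    (poch qX qQ (N - m) / poch qX qQ N) * (poch qQ qQ N / poch qQ qQ (N - m)) - 1 * 1.
  by rewrite mulr1 [in RHS]mulrACA [X in _ = _ * X - _]mulrC mulrA.
rewrite E; apply: small_congM.
- by apply: smallMr; [apply: small_poch|apply: small_pochV]; left.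
- exact: small1.
- by apply: small_poch_ratio; [left|lia|lia].
- by apply: small_poch_ratio; [right|lia|lia].
Qed.

Lemma small_gf_term m : (0 < m)%N -> small (m ^ 2) (gf_term m).
Proof.
move=> m0; apply: smallMr; first exact: small_qX.
rewrite invfM -exprM; apply: smallMr; last by apply: small_invD; rewrite muln_gt0.
rewrite /poch -prodfV; apply: small_prod => i _.
by rewrite mulNr opprK -exprM -exprS; apply: small_invD.
Qed.

Lemma small_iqp n : small 0 (iqp qX n).
Proof. by apply: small_pochV; right. Qed.

Lemma small_rqs m n : small 0 (rqs qX m n).
Proof. by rewrite /rqs; case: ifP => _; [apply: small_iqp|apply: small0]. Qed.

(** Origin of 3n + 3: [hecke_poly u] vanishes modulo X^(n+1) once u >= 2n + 2, and for u <= 2n + 1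
    its weight is 1 modulo X^(n+1) since u + (n + 1) <= N. On the other side X^(m^2) kills the terms
    of index above n. *)
Lemma hecke_gf n N M : (3 * n + 3 <= N)%N -> (n <= M)%N ->
  small n.+1 ((hecke N)%:F - \sum_(m < M) gf_term m.+1).
Proof.
move=> nN nM.
pose W u := poch qQ qQ N ^+ 2 * rqs qX N u * iqp qX (N + u).
pose w m := poch qX qQ (N - m) * poch qQ qQ N * rqs qX N m / poch qX qQ N.
have W0 u : small 0 (W u).
  by rewrite /W expr2; do !apply: smallMr; try (by apply: small_poch; right);
    [apply: small_rqs | apply: small_iqp].
have w0 m : small 0 (w m).
  by rewrite /w; do !apply: smallMr; try (by apply: small_poch; auto);
    [apply: small_rqs | apply: small_pochV; left].
have := @hecke_finite _ qX qX_neq0 qX_nroot N => E.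
apply: (@small_trans _ _ (\sum_(m < N) gf_term m.+1 * w m.+1)).
  rewrite -[X in _ - X]E rmorph_sum -sumrB; apply: small_sum => u _.
  rewrite -hecke_polyE -/(W u.+1) -[X in X - _]mulr1 -mulrBr.
  case: (leqP n.+1.*2 u.+1) => nu.
    apply: smallMr; first exact: small_hecke_poly.
    by apply: smallB; [exact: small1|exact: W0].
  rewrite mulrC; apply: smallMr; last exact: small_int.
  rewrite -opprB; apply: smallN; apply: hecke_weight; lia.
pose f m := gf_term m.+1 * w m.+1.
have cut (G : nat -> {fraction {poly int}}) K : (n <= K)%N ->
   (forall m, (n <= m)%N -> small n.+1 (G m)) ->
   small n.+1 (\sum_(m < K) G m - \sum_(m < n) G m).
  move=> nK h; rewrite -!(big_mkord xpredT G) (big_cat_nat (leq0n n) nK) /= addrAC subrr add0r.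
  by rewrite big_seq_cond; apply: small_sum => m /andP[]; rewrite mem_index_iota => /andP[/h].
have g_small m : (n <= m)%N -> small n.+1 (gf_term m.+1).
  move=> nm; apply: smallW (small_gf_term (ltn0Sn m)); have := leq_mul nm nm; lia.
apply: (@small_trans _ _ (\sum_(m < n) f m)).
  apply: (cut f); first lia.
  by move=> m nm; apply: smallMr; [exact: g_small | exact: w0].
apply: (@small_trans _ _ (\sum_(m < n) gf_term m.+1)); last first.
  by rewrite -opprB; apply: smallN; apply: (cut (fun m => gf_term m.+1)).
rewrite -sumrB; apply: small_sum => m _; rewrite /f.
rewrite -[X in _ - X]mulr1 -mulrBr mulrC; apply: smallMr.
  by apply: gf_weight; have := ltn_ord m; lia.
exact: smallW (small_gf_term (ltn0Sn m)).
Qed.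

(** * Admissible partitions and their generating function *)

Definition allowed (m k j : nat) : bool :=
  if odd k then (0 < j)%N == (k <= m.*2.-1)%N else (k == m.*2) || (j == 0).

Definition sign_exp (k j : nat) : nat := if odd k then j.-1 else j.

(** For fixed m, [allowed] constrains each multiplicity separately and the sign is a product over
    the parts, so the generating function of the partitions with largest odd part 2m - 1 factors. *)
Definition part_poly (n m k : nat) : {poly int} :=
  \sum_(j < n.+1) if allowed m k j then (-1) ^+ sign_exp k j *: 'X^(j * k) else 0.

Definition all_allowed n (mu : multiplicities n) m :=
  [forall k : 'I_n.+1, allowed m k (mu k)].

Lemma mult_ord n (mu : multiplicities n) (k : 'I_n.+1) : mult mu k = mu k.
Proof. by rewrite /mult valK. Qed.

Lemma mult_out n (mu : multiplicities n) k : (n < k)%N -> mult mu k = 0%N.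
Proof. by move=> nk; rewrite /mult insubF // ltnS leqNgt nk. Qed.

(** The witness is shifted: the largest odd part is 2m + 1, and [m.*2 < n] says that it is at most
    n. [all_allowed] inspects only parts up to n and cannot tell apart values of m beyond that. *)
Lemma admissibleP n (mu : multiplicities n) :
  admissible (mult mu) <-> exists m : 'I_n, (m.*2 < n)%N && all_allowed mu m.+1.
Proof.
split=> [[m [m0 odds evens]]|[m /andP[mn /forallP ok]]].
  have mn : (m.*2.-1 <= n)%N.
    rewrite leqNgt; apply/negP => nm; have o : odd m.*2.-1 by lia.
    by have := odds _ o; rewrite mult_out // leqnn.
  have mn' : (m.-1 < n)%N by lia.
  exists (Ordinal mn'); rewrite /= prednK //; apply/andP; split; first lia.
  apply/forallP => k; rewrite /allowed -mult_ord; case: ifP => ok.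
    by rewrite odds.
  apply/orP; have [h|h] := posnP (mult mu k); first by right; apply/eqP.
  by left; apply/eqP/evens; rewrite ?ok.
exists m.+1; split=> // k ok_k.
  case: (ltnP n k) => nk.
    by rewrite mult_out //; apply/esym/negbTE; rewrite -ltnNge; lia.
  have := ok (inord k); rewrite /allowed inordK // ok_k => /eqP <-.
  by rewrite -mult_ord inordK.
move=> k0; case: (ltnP n k) => nk; first by move: k0; rewrite mult_out.
have := ok (inord k); rewrite /allowed inordK // (negbTE ok_k) -mult_ord inordK //.
by case/orP => /eqP // k00; move: k0; rewrite k00.
Qed.

Lemma all_allowed_uniq n (mu : multiplicities n) m m' :
  (m.*2 < n)%N -> (m'.*2 < n)%N -> all_allowed mu m.+1 -> all_allowed mu m'.+1 ->
  m = m'.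
Proof.
wlog lt : m m' / (m < m')%N => [W|].
  by case: (ltngtP m m') => // h *; [apply: W|apply/esym/W].
move=> mn mn' /forallP h /forallP h'.
(* The part 2m' + 1 separates the two: it must occur for m' and is too large for m. *)
have kn : (m'.*2.+1 < n.+1)%N by [].
have := h (Ordinal kn); have := h' (Ordinal kn).
rewrite /allowed /= odd_double /= leqnn => /eqP -> /eqP/esym; lia.
Qed.

Lemma coef_prod_part_poly n m :
  (\prod_(k < n.+1) part_poly n m.+1 k)`_n =
  \sum_(mu : multiplicities n | is_partition mu && all_allowed mu m.+1)
    (-1) ^+ (odd_repetitions mu + even_appearances mu).
Proof.
rewrite /part_poly bigA_distr_bigA coef_sum [RHS]big_mkcond; apply: eq_bigr => mu _ /=.
case: (boolP (all_allowed _ _)) => [/forallP ok|]; last first.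
  rewrite andbF; case/forallPn => k /negbTE nok.
  by rewrite (bigD1 k) //= nok mul0r coef0.
under eq_bigr => k _ do rewrite ok.
rewrite scaler_prod -!expr_sum coefZ coefXn andbT.
have -> : \sum_(k < n.+1) sign_exp k (mu k) = (odd_repetitions mu + even_appearances mu)%N.
  rewrite (bigID (fun k : 'I_n.+1 => odd k)) /=; congr (_ + _)%N; apply: eq_bigr => k ok_k.
    by rewrite /sign_exp ok_k mult_ord.
  by rewrite /sign_exp (negbTE ok_k) mult_ord.
have mu0 : mult mu 0 = 0%N.
  by have := ok ord0; rewrite /allowed /= -mult_ord => /eqP.
rewrite /is_partition mu0 eqxx /= eq_sym.
under eq_bigr => k _ do rewrite -mult_ord.
by case: ifP => _; rewrite ?mulr1 ?mulr0.
Qed.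

Lemma p1E n : p1 n =
  \sum_(m < n | (m.*2 < n)%N) (\prod_(k < n.+1) part_poly n m.+1 k)`_n.
Proof.
under [RHS]eq_bigr => m _ do rewrite coef_prod_part_poly big_mkcondr.
rewrite exchange_big /= /p1 big_mkcondr; apply: eq_bigr => mu _.
rewrite -big_mkcondr; case: asboolP => [/admissibleP[m hm]|h].
  rewrite (big_pred1 m) // => m'; apply/idP/eqP => [/andP[h1 h2]|-> //].
  by case/andP: hm => h3 h4; apply: val_inj; apply: all_allowed_uniq h1 h3 h2 h4.
rewrite big_pred0 // => m; apply/negP => hm; apply: h.
by apply/admissibleP; exists m.
Qed.

(** The full geometric series that [part_poly n m k] truncates; the two agree modulo X^(n+1). *)
Definition part_factor (m k : nat) : {fraction {poly int}} :=
  if odd k then (if (k <= m.*2.-1)%N then qX ^+ k / (1 + qX ^+ k) else 1)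
  else if k == m.*2 then (1 + qX ^+ k)^-1 else 1.

Lemma geometric_alt (F : fieldType) (x : F) n : 1 + x != 0 ->
  \sum_(j < n) (-1) ^+ j * x ^+ j = (1 - (- x) ^+ n) / (1 + x).
Proof.
move=> x0; apply: (mulIf x0); rewrite mulfVK //; elim: n => [|n IH].
  by rewrite big_ord0 mul0r expr0 subrr.
rewrite big_ord_recr /= mulrDl IH -exprMn mulN1r exprS; ring.
Qed.

Lemma small_part_factor m k : (0 < m)%N -> small 0 (part_factor m k).
Proof.
move=> m0; rewrite /part_factor; case: ifP => ok; case: ifP => km; try exact: small1.
  apply: smallMr; first exact: smallW (small_qX _).
  by apply: small_invD; rewrite odd_gt0.
by apply: small_invD; move/eqP: km => ->; rewrite double_gt0.
Qed.

Lemma part_polyE n m k : (0 < m)%N ->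
  small n.+1 ((part_poly n m k)%:F - part_factor m k).
Proof.
move=> m0.
have E : (part_poly n m k)%:F =
    \sum_(j < n.+1) if allowed m k j then (-1) ^+ sign_exp k j * (qX ^+ k) ^+ j else 0.
  rewrite rmorph_sum; apply: eq_bigr => j _; case: ifP => _; last exact: rmorph0.
  by rewrite -mul_polyC rmorphM !rmorphXn !rmorphN !rmorph1 -exprM mulnC.
have lone : (forall j, allowed m k j = (j == 0%N)) -> (part_poly n m k)%:F = 1.
  move=> h; rewrite E big_ord_recl h /= expr0 mulr1 big1 => [|j _]; last by rewrite h.
  by rewrite addr0 /sign_exp; case: ifP.
rewrite /part_factor; have [ok|ek] := boolP (odd k).
  have k0 : (0 < k)%N by rewrite odd_gt0.
  have nz := @q_nrootN _ qX qX_nroot k k0.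
  have [km|km] := boolP (k <= m.*2.-1)%N; last first.
    rewrite lone ?subrr => [|j]; first exact: small0.
    by rewrite /allowed ok (negbTE km) lt0n eqbF_neg negbK.
  rewrite E big_ord_recl /allowed /sign_exp ok km /= add0r.
  under eq_bigr => j _ do rewrite exprS mulrCA.
  rewrite -mulr_sumr geometric_alt // mulrA -mulrBl mulrBr mulr1 addrC addKr.
  apply: smallMr; last exact: small_invD.
  apply: smallN; rewrite exprNn mulrCA -exprS -exprM mulrC; apply: smallMr.
    by apply: smallW (small_qX _); rewrite leq_pmull.
  by have := small_int ((-1) ^+ n); rewrite rmorphXn rmorphN rmorph1.
have [km|km] := eqVneq k m.*2; last first.
  rewrite lone ?subrr => [|j]; first exact: small0.
  by rewrite /allowed (negbTE ek) (negbTE km).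
have k0 : (0 < k)%N by rewrite km double_gt0.
have nz := @q_nrootN _ qX qX_nroot k k0.
rewrite E /allowed /sign_exp (negbTE ek) -km eqxx /= geometric_alt // mulrBl mul1r.
rewrite addrAC subrr add0r; apply/smallN/smallMr; last exact: small_invD.
rewrite exprNn -exprM mulrC; apply: smallMr.
  by apply: smallW (small_qX _); rewrite leq_pmull.
by have := small_int ((-1) ^+ n.+1); rewrite rmorphXn rmorphN rmorph1.
Qed.

Lemma prod_part_factor_odd m i : (i <= m)%N ->
  \prod_(k < i.*2) part_factor m k = qX ^+ (i ^ 2) / poch (- qX) qQ i.
Proof.
elim: i => [|i IH] im; first by rewrite big_ord0 poch0 expr0 divr1.
rewrite doubleS 2!big_ord_recr /= IH 1?ltnW // pochS mulNr opprK -exprM -exprS.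
rewrite /part_factor /= odd_double /= ifN_eq; last by apply/eqP; lia.
rewrite ifT; last lia.
have -> : (i.+1 ^ 2 = i ^ 2 + i.*2.+1)%N by lia.
by rewrite mulr1 mul2n exprD invfM mulrACA.
Qed.

Lemma prod_part_factor m K : (m.*2 < K)%N -> \prod_(k < K) part_factor m k = gf_term m.
Proof.
move=> mK; rewrite -(big_mkord xpredT) (big_cat_nat (leq0n m.*2.+1) mK) /=.
rewrite [X in _ * X]big1_seq ?mulr1.
  rewrite big_mkord big_ord_recr /= prod_part_factor_odd // /gf_term.
  by rewrite /part_factor odd_double eqxx invfM mulrA -exprM mul2n.
move=> k; rewrite mem_index_iota => /andP[_ /andP[mk _]]; rewrite /part_factor.
by case: ifP => ok; [rewrite ifN // -ltnNge|rewrite ifN_eq //; apply/eqP]; lia.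
Qed.

Lemma prod_part_poly n m : (0 < m)%N -> (m.*2.-1 <= n)%N ->
  small n.+1 ((\prod_(k < n.+1) part_poly n m k)%:F - gf_term m).
Proof.
move=> m0 mn; rewrite rmorph_prod.
apply: (@small_trans _ _ (\prod_(k < n.+1) part_factor m k)).
  apply: (small_cong_prod (G := fun k => (part_poly n m k)%:F)) => k _.
  - exact: small_int.
  - exact: small_part_factor.
  - exact: part_polyE.
(* If n = 2m - 1, the even part 2m = n + 1 lies just outside the product. One more factor is
   therefore added; it is 1 modulo X^(n+1). *)
rewrite -(@prod_part_factor m n.+2); last lia.
rewrite [X in _ - X]big_ord_recr /= -[X in X - _]mulr1 -mulrBr mulrC.
apply: smallMr; last by apply: small_prod => k _; apply: small_part_factor.
rewrite /part_factor; case: ifP => ok; case: ifP => km; rewrite ?subrr; try exact: small0.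
  by move: km; rewrite leqNgt; lia.
by rewrite -opprB; apply: smallN; apply: small_1D.
Qed.

Lemma p1_hecke n N : (3 * n + 3 <= N)%N -> p1 n = (hecke N)`_n.
Proof.
move=> nN; apply/eqP; rewrite -subr_eq0 p1E -coef_sum -coefB; apply/eqP.
apply: (@coef_small n.+1) => //.
rewrite rmorphB -opprB; apply: smallN; apply: small_trans (hecke_gf nN (leqnn n)) _.
rewrite rmorph_sum [X in _ - X]big_mkcond -sumrB; apply: small_sum => m _.
(* Indices with n <= 2m are absent from [p1E]; there (m + 1)^2 > n, so [gf_term m.+1] vanishes
   modulo X^(n+1). *)
case: ifP => mn; last first.
  rewrite subr0; apply: smallW (small_gf_term (ltn0Sn m)).
  have : (n <= m.*2)%N by lia.
  lia.
by rewrite -opprB; apply: smallN; apply: prod_part_poly; rewrite // doubleS.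
Qed.

(** * Lattice points of the Hecke-type sum *)

Lemma hecke_coef N n : (hecke N)`_n =
  \sum_(u < N) \sum_(w < u.+1)
    (-1) ^+ uphalf w * (n == u.+1 ^ 2 - 2 * uphalf w ^ 2)%N%:R.
Proof.
rewrite coef_sum; apply: eq_bigr => u _; rewrite coef_sum; apply: eq_bigr => w _.
by rewrite coefZ coefXn.
Qed.

Lemma p1_neq0_norm n : p1 n != 0 -> exists u v, (0 < u)%N /\ (n + 2 * v ^ 2 = u ^ 2)%N.
Proof.
rewrite (p1_hecke (leqnn _)) hecke_coef => nz.
have [/existsP[u /existsP[w /eqP E]]|h] := boolP [exists u : 'I_(3 * n + 3),
    exists w : 'I_u.+1, n == u.+1 ^ 2 - 2 * uphalf w ^ 2]%N.
  exists u.+1, (uphalf w); split=> //.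
  by have := uphalf_sqr_le (ltn_ord w); lia.
case/eqP: nz; apply: big1 => u _; apply: big1 => w _.
move/existsPn: h => /(_ u) /existsPn /(_ w) /negbTE ->.
by rewrite mulr0.
Qed.

Lemma sum_root_le N x : (\sum_(u < N) (u.+1 ^ 2 <= x) * u.+1 <= x)%N.
Proof.
(* The bound N^2 drives the induction: as long as (N + 1)^2 <= x, the new sum is at most (N + 1)^2,
   hence at most x. *)
suff: (\sum_(u < N) (u.+1 ^ 2 <= x) * u.+1 <= x /\
       \sum_(u < N) (u.+1 ^ 2 <= x) * u.+1 <= N ^ 2)%N by case.
elim: N => [|N [IH1 IH2]]; first by rewrite big_ord0.
rewrite big_ord_recr /=; have [h|h] := boolP (N.+1 ^ 2 <= x)%N.
  have: (\sum_(u < N) (u.+1 ^ 2 <= x) * u.+1 + 1 * N.+1 <= N.+1 ^ 2)%N.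
    by apply: leq_trans (leq_add IH2 (leqnn _)) _; lia.
  by move=> h2; split; [exact: leq_trans h2 h | exact: h2].
by rewrite mul0n addn0; split=> //; apply: leq_trans IH2 _; lia.
Qed.

(** A point with u^2 - 2v^2 <= x has u^2 <= 2x, since 2v^2 <= u^2 / 2, and each u carries u values
    of v. What remains is the sum of u over u^2 <= 2x. *)
Lemma sum_absz_p1 x : (\sum_(n < x.+1) `|p1 n| <= 2 * x)%N.
Proof.
pose N := (3 * x + 3)%N.
apply: leq_trans (sum_root_le N (2 * x)).
have step (n : 'I_x.+1) :
    (`|p1 n| <= \sum_(u < N) \sum_(w < u.+1) (n == u.+1 ^ 2 - 2 * uphalf w ^ 2 :> nat))%N.
  rewrite -lez_nat abszE (@p1_hecke n N) ?hecke_coef; last first.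
    by rewrite /N; have := ltn_ord n; lia.
  apply: le_trans (ler_norm_sum _ _ _) _; rewrite -natz natr_sum; apply: ler_sum => u _.
  apply: le_trans (ler_norm_sum _ _ _) _; rewrite natr_sum; apply: ler_sum => w _.
  by rewrite normrM normrX normrN1 expr1n mul1r; case: (_ == _).
apply: leq_trans (leq_sum _ (fun n _ => step n)) _.
rewrite exchange_big; apply: leq_sum => u _; rewrite exchange_big.
rewrite mulnC -[X in (X * _)%N]card_ord -sum_nat_const; apply: leq_sum => w _ /=.
have := uphalf_sqr_le (ltn_ord w).
set v := (2 * uphalf w ^ 2)%N; set s := (u.+1 ^ 2)%N => vs.
case: (leqP (s - v) x) => sx.
  have sx' : (s - v < x.+1)%N by [].
  rewrite (bigD1 (Ordinal sx')) //= eqxx big1 => [|n /negbTE]; last first.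
    by rewrite -val_eqE /= => ->.
  by rewrite addn0; case: leqP => //; lia.
rewrite big1 => // n _; case: eqP => // nE.
by have := ltn_ord n; lia.
Qed.

(** * Norms from Z[sqrt 2] *)

Section Norms.
Local Open Scope nat_scope.

(* Fermat descent: if [x] is odd and [x < m], then [x ^ 2 - 2 = m * k] with [k < m],
   and reducing mod 8 shows that [k] is again [3] or [5] mod [8]. *)
Lemma two_nonresidue m x k : (m %% 8 == 3) || (m %% 8 == 5) -> x ^ 2 <> m * k + 2.
Proof.
elim/ltn_ind: m x k => m IH x k m8 E.
have m3 : 2 < m by lia.
have shift z a b : z ^ 2 + m * a = m * b + 2 -> exists c, z ^ 2 = m * c + 2.
  move=> h; exists (b - a); have [ab|ba] := leqP a b; first by rewrite mulnBr; nia.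
  by exfalso; nia.
have {x k E} [x [k [xm xo E]]] : exists x k, [/\ x < m, odd x & x ^ 2 = m * k + 2].
  pose y := x %% m; have ym : y < m by rewrite ltn_mod; lia.
  have [l Ey] : exists l, y ^ 2 = m * l + 2.
    apply: (shift y ((x %/ m) ^ 2 * m + 2 * (x %/ m) * y) k); rewrite -E.
    by rewrite [in RHS](divn_eq x m) -/y; ring.
  have [yo|ye] := boolP (odd y); first by exists y, l.
  have [l' Ey'] : exists l', (m - y) ^ 2 = m * l' + 2.
    apply: (shift (m - y) (2 * y) (m + l)).
    have -> : m * (m + l) + 2 = m ^ 2 + y ^ 2 by rewrite Ey; ring.
    by move: (ltnW ym) => /subnKC; move: (m - y) => z <-; ring.
  exists (m - y), l'; split=> //; last by rewrite oddB ?(ltnW ym) // (negbTE ye); lia.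
  have [y0|] := posnP y; last by lia.
  by move: Ey; rewrite y0; lia.
have km : k < m.
  have h : x ^ 2 < m ^ 2 by rewrite ltn_sqr.
  by rewrite -(ltn_pmul2l (m := m)); lia.
have k8 : (k %% 8 == 3) || (k %% 8 == 5).
  have x8 : x ^ 2 %% 8 = 1.
    rewrite -modnXm; have : x %% 8 < 8 by rewrite ltn_mod.
    have : odd (x %% 8) by rewrite odd_mod.
    by move: (x %% 8) => [|[|[|[|[|[|[|[|]]]]]]]].
  have : (m %% 8 * (k %% 8) + 2) %% 8 = 1 by rewrite -modnDml modnMm modnDml -E.
  have : k %% 8 < 8 by rewrite ltn_mod.
  case/orP: m8 => /eqP ->; by move: (k %% 8) => [|[|[|[|[|[|[|[|]]]]]]]].
by apply: (IH k km x m k8); rewrite E mulnC.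
Qed.

Definition split_only (s : nat) : bool :=
  all (fun p => (p %% 8 == 1) || (p %% 8 == 7)) (primes s).

(** By coprimality p does not divide v, so u / v is a square root of 2 modulo p, which
    [two_nonresidue] excludes for the classes 3 and 5. *)
Lemma prime_dvd_norm p n u v : prime p -> odd p -> coprime u v -> p %| n ->
  n + 2 * v ^ 2 = u ^ 2 -> (p %% 8 == 1) || (p %% 8 == 7).
Proof.
move=> pp po cuv pn E.
have pv : coprime v p.
  rewrite coprime_sym prime_coprime //; apply/negP => pv.
  have : p %| u ^ 2 by rewrite -E dvdn_add // dvdn_mull // dvdn_exp.
  rewrite Euclid_dvdX // => /andP[pu _].
  have : p %| gcdn u v by rewrite dvdn_gcd pu.
  by rewrite (eqP cuv) dvdn1 => /eqP p1; move: pp; rewrite p1.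
have p0 := prime_gt0 pp.
have [v0 | v0] := posnP v.
  move: pv; rewrite v0 /coprime gcd0n => /eqP p1; by move: pp; rewrite p1.
have [t b Eb _] := egcdnP p v0.
move: Eb; rewrite (eqP pv) => Et.
have [n' En] := dvdnP pn.
have E2 : (t * u) ^ 2 = p * (n' * t ^ 2 + 2 * b * (b * p + 2)) + 2.
  rewrite expnMn -E En.
  have -> : t ^ 2 * (n' * p + 2 * v ^ 2) = n' * t ^ 2 * p + 2 * (t * v) ^ 2 by ring.
  by rewrite Et; ring.
have := @two_nonresidue p (t * u) _ ^~ E2.
have : p %% 8 < 8 by rewrite ltn_mod.
have : odd (p %% 8) by rewrite odd_mod.
by move: (p %% 8) => [|[|[|[|[|[|[|[|]]]]]]]] //= _ _ /(_ isT).
Qed.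

(** Division by gcd(u, v)^2 leaves the norm m of a coprime pair, and [prime_dvd_norm] applies to its
    odd prime factors. In the power 2^a dividing m, the parity of a gives e and the rest joins the
    square. *)
Lemma norm_decomp n u v : 0 < n -> n + 2 * v ^ 2 = u ^ 2 ->
  exists e g s, [/\ e < 2, 0 < g, 0 < s, split_only s & n = 2 ^ e * g ^ 2 * s].
Proof.
move=> n0 E.
have u0 : 0 < u by rewrite lt0n; apply: contraL n0 => /eqP u0; lia.
pose d := gcdn u v; have d0 : 0 < d by rewrite gcdn_gt0 u0.
have [u' Eu] := dvdnP (dvdn_gcdl u v); have [v' Ev] := dvdnP (dvdn_gcdr u v).
rewrite -/d in Eu Ev.
have cuv : coprime u' v'.
  rewrite /coprime -(eqn_pmul2r d0) mul1n muln_gcdl -Eu -Ev; exact: eqxx.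
have lev : 2 * v' ^ 2 <= u' ^ 2.
  have h : 2 * v ^ 2 <= u ^ 2 by rewrite -E leq_addl.
  by move: h; rewrite Eu Ev !expnMn mulnA leq_pmul2r // expn_gt0 d0.
pose m := u' ^ 2 - 2 * v' ^ 2.
have Em : m + 2 * v' ^ 2 = u' ^ 2 by rewrite subnK.
have En : n = m * d ^ 2.
  move: E Em; rewrite Eu Ev !expnMn; move: (d ^ 2) (u' ^ 2) (v' ^ 2) => x y z h1 h2.
  by apply/eqP; rewrite -(eqn_add2r (2 * (z * x))) h1 -h2; apply/eqP; ring.
have m0 : 0 < m by move: n0; rewrite En muln_gt0 => /andP[].
pose a := logn 2 m.
have [s Es] := dvdnP (pfactor_dvdnn 2 m); rewrite -/a in Es.
have s0 : 0 < s by move: m0; rewrite Es muln_gt0 => /andP[].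
have so : odd s.
  rewrite -coprime2n; have := pfactor_coprime (isT : prime 2) m0.
  case=> s' cs' Es'; suff -> : s = s' by [].
  by apply/eqP; rewrite -(eqn_pmul2r (m := 2 ^ a)) ?expn_gt0 // -Es {1}Es'.
exists (odd a), (2 ^ a./2 * d), s; split=> //.
- by case: odd.
- by rewrite muln_gt0 expn_gt0 d0.
- apply/allP => p; rewrite mem_primes => /and3P[pp _ ps].
  apply: (@prime_dvd_norm p m u' v') => //; last by rewrite Es dvdn_mulr.
  by apply: dvdn_odd ps so.
- rewrite En Es -{1}(odd_double_half a) expnD -muln2 expnM expnMn; ring.
Qed.
End Norms.

(** * Abel summation and the character (2/n) *)

Lemma abel_ge0 (R : realDomainType) (b w : nat -> R) n :
  (forall k, 0 <= w k.+1 <= w k) -> (forall k, 0 <= \sum_(i < k) b i) ->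
  0 <= w 0 -> 0 <= \sum_(i < n) b i * w i.
Proof.
move=> hw hb w0; case: n => [|n]; first by rewrite big_ord0.
have wn k : 0 <= w k by case: k => // k; case/andP: (hw k).
(* This stronger bound is inductive: the next step only lowers the weight of a nonnegative prefix
   sum. *)
suff : (\sum_(i < n.+1) b i) * w n <= \sum_(i < n.+1) b i * w i.
  by move=> h; apply: le_trans h; apply: mulr_ge0.
elim: n => [|n IH]; first by rewrite !big_ord1.
rewrite big_ord_recr [in leRHS]big_ord_recr /= mulrDl lerD2r; apply: le_trans IH.
by apply: ler_wpM2l; [exact: hb|case/andP: (hw n)].
Qed.

Lemma abel_le (R : realDomainType) (a b w : nat -> R) n :
  (forall k, 0 <= w k.+1 <= w k) -> 0 <= w 0 ->
  (forall k, \sum_(i < k) a i <= \sum_(i < k) b i) ->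
  \sum_(i < n) a i * w i <= \sum_(i < n) b i * w i.
Proof.
move=> hw w0 hab; rewrite -subr_ge0 -sumrB; under eq_bigr do rewrite -mulrBl.
apply: (abel_ge0 (b := fun i => b i - a i)) => // k; by rewrite sumrB subr_ge0.
Qed.

(* The Jacobi symbol (2/n), extended by 0 to even n. *)
Definition chi8 (n : nat) : int :=
  if ((n %% 8 == 1) || (n %% 8 == 7))%N then 1
  else if ((n %% 8 == 3) || (n %% 8 == 5))%N then -1 else 0.

Lemma chi8M m n : chi8 (m * n) = chi8 m * chi8 n.
Proof.
rewrite /chi8 -modnMm; move: (ltn_pmod m (isT : 0 < 8)%N) (ltn_pmod n (isT : 0 < 8)%N).
move: (m %% 8)%N (n %% 8)%N.
by do 8?[case=> //]; do 8?[case=> //].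
Qed.

Lemma chi8X m k : chi8 (m ^ k) = chi8 m ^+ k.
Proof. by elim: k => // k IH; rewrite expnS chi8M IH exprS. Qed.

Lemma chi8_sum n : \sum_(d < n) chi8 d.+1 <= 1.
Proof.
suff -> : \sum_(d < n) chi8 d.+1 = if (n %% 8 \in [:: 1; 2])%N then 1
   else if (n %% 8 \in [:: 5; 6])%N then -1 else 0 by do !case: ifP.
elim: n => [|n IH]; first by rewrite big_ord0.
rewrite big_ord_recr /= IH /chi8 -[n.+1]addn1 -modnDml.
move: (ltn_pmod n (isT : 0 < 8)%N); move: (n %% 8)%N.
by do 8?[case=> //].
Qed.

Definition div_chi (n : nat) : int := \sum_(d <- divisors n) chi8 d.

Lemma divisors_pfactorM p k m : prime p -> (0 < m)%N -> coprime p m ->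
  perm_eq (divisors (m * p ^ k)) [seq (e * p ^ i)%N | i <- iota 0 k.+1, e <- divisors m].
Proof.
move=> pp m0 cpm; have p0 := prime_gt0 pp.
have pk j : (0 < p ^ j)%N by rewrite expn_gt0 p0.
have logn_e e i : (e %| m)%N -> logn p (e * p ^ i) = i.
  move=> em; have e0 : (0 < e)%N by apply: dvdn_gt0 em.
  rewrite lognM // pfactorK // (_ : logn p e = 0%N) //.
  by apply: logn_coprime; apply: coprime_dvdr em cpm.
apply: uniq_perm; first exact: divisors_uniq.
  apply: allpairs_uniq; [exact: iota_uniq | exact: divisors_uniq|].
  move=> x y /allpairsP hx /allpairsP hy; case: hx => -[i' e'] [_ /= h ->]; case: hy => -[j' f'] [_ /= h' ->] /= E.
  rewrite -dvdn_divisors // in h; rewrite -dvdn_divisors // in h'.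
  have ij : i' = j' by rewrite -(logn_e e' i' h) E logn_e.
  by move: E; rewrite ij => /eqP; rewrite eqn_pmul2r // => /eqP ->.
have mp0 : (0 < m * p ^ k)%N by rewrite muln_gt0 m0 pk.
move=> d; rewrite -dvdn_divisors //; apply/idP/allpairsP; last first.
  move=> [[i e] []]; rewrite mem_iota /= add0n ltnS -dvdn_divisors // => ik em ->.
  by apply: dvdn_mul => //; apply: dvdn_exp2l.
move=> dm; have d0 : (0 < d)%N by apply: dvdn_gt0 dm.
have [e cpe Ed] := pfactor_coprime pp d0.
exists (logn p d, e); split=> //.
  rewrite mem_iota /= add0n ltnS -[k](logn_e 1%N) ?dvd1n // mul1n.
  have -> : logn p (p ^ k) = logn p (m * p ^ k) by rewrite logn_e // pfactorK.
  exact: dvdn_leq_log.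
rewrite /= -dvdn_divisors // -(@Gauss_dvdl e m (p ^ k)).
  by apply: dvdn_trans dm; rewrite Ed dvdn_mulr.
by rewrite coprimeXr // coprime_sym.
Qed.

Lemma sum_chi8X_ge0 p k : 0 <= \sum_(0 <= i < k) chi8 p ^+ i.
Proof.
rewrite /chi8; do 2?case: ifP => _.
- by apply: sumr_ge0 => i _; rewrite expr1n.
- suff -> : \sum_(0 <= i < k) (-1) ^+ i = (odd k : nat)%:R :> int by [].
  elim: k => [|k IH]; first by rewrite big_geq.
  by rewrite big_nat_recr //= IH -signr_odd; case: (odd k).
- by apply: sumr_ge0 => i _; rewrite expr0n.
Qed.

(** The divisor sum is multiplicative. Splitting off the full power of the least prime p leaves a
    factor that is a partial sum of 1 + 1 + ..., 1 - 1 + 1 - ... or 1 + 0 + ..., never negative. *)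
Lemma div_chi_ge0 n : 0 <= div_chi n.
Proof.
elim/ltn_ind: n => n IH; have [n1|n1] := leqP n 1.
  by case: n n1 {IH} => [|[|n]] // _; rewrite /div_chi /= big_seq1.
have n0 : (0 < n)%N by apply: ltnW.
have pp := pdiv_prime n1; set p := pdiv n in pp.
have [m cpm En] := pfactor_coprime pp n0.
have m0 : (0 < m)%N by move: n0; rewrite En muln_gt0 => /andP[].
have k0 : (0 < logn p n)%N by rewrite logn_gt0 mem_primes pp n0 pdiv_dvd.
rewrite /div_chi En (perm_big _ (divisors_pfactorM _ pp m0 cpm)) big_allpairs_dep.
have -> : \sum_(i <- iota 0 (logn p n).+1) \sum_(e <- divisors m) chi8 (e * p ^ i)
   = (\sum_(0 <= i < (logn p n).+1) chi8 p ^+ i) * div_chi m.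
  rewrite big_distrl /= /index_iota subn0; apply: eq_bigr => i _; rewrite big_distrr /=.
  by apply: eq_bigr => e _; rewrite chi8M chi8X mulrC.
rewrite mulr_ge0 ?sum_chi8X_ge0 // IH //.
rewrite [ltnRHS]En -{1}[m]muln1 ltn_pmul2l //.
by rewrite -(expn0 p) ltn_exp2l // prime_gt1.
Qed.

Lemma split_only_dvd d n : (0 < n)%N -> (d %| n)%N -> split_only n -> split_only d.
Proof.
move=> n0 dn /allP h; apply/allP => p; rewrite mem_primes => /and3P[pp _ pd].
by apply: h; rewrite mem_primes pp n0 (dvdn_trans pd dn).
Qed.

Lemma split_only_mul a b : (0 < a)%N -> (0 < b)%N -> split_only a -> split_only b ->
  split_only (a * b).
Proof.
move=> a0 b0 /allP ha /allP hb; apply/allP => p; rewrite primesM // => /orP[]; auto.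
Qed.

Lemma chi8_split n : (0 < n)%N -> split_only n -> chi8 n = 1.
Proof.
elim/ltn_ind: n => n IH n0 sn; have [n1|n1] := leqP n 1.
  by have -> : n = 1%N by lia.
have pp := pdiv_prime n1.
have [m Em] := dvdnP (pdiv_dvd n).
have m0 : (0 < m)%N by move: n0; rewrite Em muln_gt0 => /andP[].
have mn : (m < n)%N by rewrite [ltnRHS]Em -{1}[m]muln1 ltn_pmul2l // prime_gt1.
rewrite Em chi8M IH ?mul1r //; last first.
  by apply: split_only_dvd sn => //; rewrite Em dvdn_mulr.
have := allP sn (pdiv n); rewrite mem_primes pp n0 pdiv_dvd => /(_ isT).
by rewrite /chi8 => ->.
Qed.

Lemma div_chi_split n : (0 < n)%N -> split_only n -> div_chi n = (size (divisors n))%:R.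
Proof.
move=> n0 sn; rewrite /div_chi big_seq_cond (eq_bigr (fun=> 1)); last first.
  move=> d; rewrite andbT -dvdn_divisors // => dn; apply: chi8_split.
    exact: dvdn_gt0 dn.
  exact: split_only_dvd sn.
by rewrite -big_seq_cond big_const_seq count_predT -Monoid.iteropE.
Qed.

(** * Counting norms *)

Section SplitSums.
Variable R : realType.
Implicit Types (x y n : nat).

Definition split_harmonic y : R := \sum_(1 <= s < y.+1 | split_only s) s%:R^-1.

Lemma sum_nat_delta k Y (F : nat -> R) : (0 < k)%N ->
  \sum_(1 <= n < Y.+1) (k == n)%:R * F n = (k <= Y)%:R * F k.
Proof.
move=> k0; case: leqP => kY; last first.
  rewrite mul0r big_nat big1 // => n /andP[_ nY].
  by rewrite (_ : (k == n) = false) ?mul0r //; apply/eqP; lia.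
rewrite (bigD1_seq k) ?iota_uniq ?mem_index_iota ?k0 ?ltnS //= eqxx.
by rewrite big1 ?addr0 // => n /negbTE nk; rewrite eq_sym nk mul0r.
Qed.

Lemma sum_dvd_delta d n Y : (0 < d)%N -> (0 < n <= Y)%N ->
  (\sum_(1 <= e < Y.+1) (d * e == n) = (d %| n))%N.
Proof.
move=> d0 /andP[n0 nY]; case: (boolP (d %| n)%N) => [/dvdnP[e E]|nd]; last first.
  rewrite big1 // => e _; case: eqP => // E.
  by move: nd; rewrite -E dvdn_mulr.
have e0 : (0 < e)%N by move: n0; rewrite E muln_gt0 => /andP[].
rewrite (bigD1_seq e) ?iota_uniq ?mem_index_iota ?e0 ?ltnS //=; last first.
  by apply: leq_trans nY; rewrite E leq_pmulr.
rewrite E mulnC eqxx big1 // => f /negbTE fe.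
by rewrite [(e * d)%N]mulnC eqn_pmul2l // fe.
Qed.

Lemma div_chiE n Y : (0 < n <= Y)%N ->
  div_chi n = \sum_(1 <= d < Y.+1) \sum_(1 <= e < Y.+1) (d * e == n)%N%:R * chi8 d.
Proof.
move=> nY; have /andP[n0 leY] := nY.
transitivity (\sum_(1 <= d < Y.+1 | (d %| n)%N) chi8 d).
  rewrite -big_filter; apply: perm_big; apply: uniq_perm.
  - exact: divisors_uniq.
  - by apply: filter_uniq; apply: iota_uniq.
  move=> d; rewrite -dvdn_divisors // mem_filter mem_index_iota ltnS.
  case: (boolP (d %| n)%N) => //= dn; apply/esym/andP; split.
    exact: dvdn_gt0 dn.
  by apply: leq_trans leY; apply: dvdn_leq.
rewrite big_mkcond; apply: eq_big_nat => d /andP[d0 _].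
rewrite -mulr_suml -natr_sum sum_dvd_delta //.
by case: (d %| n)%N; rewrite ?mul1r ?mul0r.
Qed.

(** If n has only split primes, all its divisors have character 1, so [div_chi n] counts them, and a
    pair is determined by a. Otherwise there is no pair, and [div_chi_ge0] applies. *)
Lemma split_pairs_le n y : (0 < n)%N ->
  (\sum_(1 <= a < y.+1) \sum_(1 <= b < y.+1)
     [&& a * b == n, split_only a & split_only b])%N%:Z <= div_chi n.
Proof.
move=> n0; case: (boolP (split_only n)) => sn; last first.
  rewrite big_nat big1 ?div_chi_ge0 // => a /andP[a0 _].
  rewrite big_nat big1 // => b /andP[b0 _]; case: eqP => //= E.
  case: andP => // -[sa sb]; move: sn; rewrite -E.
  by rewrite split_only_mul.
rewrite div_chi_split // natz lez_nat.
pose Y := maxn n y.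
apply: (@leq_trans (\sum_(1 <= a < Y.+1) (a %| n))%N); last first.
  rewrite -big_mkcond sum1_count -size_filter; apply: uniq_leq_size.
    by apply: filter_uniq; apply: iota_uniq.
  by move=> d; rewrite mem_filter => /andP[dn _]; rewrite -dvdn_divisors.
apply: (@leq_trans (\sum_(1 <= a < Y.+1) \sum_(1 <= b < Y.+1) (a * b == n))%N).
  rewrite [leqRHS](big_cat_nat (n := y.+1)) //=; last by rewrite ltnS leq_maxr.
  apply: leq_trans (leq_addr _ _); apply: leq_sum => a _.
  rewrite [leqRHS](big_cat_nat (n := y.+1)) //=; last by rewrite ltnS leq_maxr.
  apply: leq_trans (leq_addr _ _); apply: leq_sum => b _.
  by case: (_ == _) => //=; case: (_ && _).
rewrite big_nat [leqRHS]big_nat; apply: leq_sum => a /andP[a0 _].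
by rewrite sum_dvd_delta // n0 leq_maxl.
Qed.

Lemma split_harmonic_sqr y :
  split_harmonic y ^+ 2 <= \sum_(1 <= n < (y ^ 2).+1) (div_chi n)%:~R / n%:R.
Proof.
have -> : split_harmonic y ^+ 2 = \sum_(1 <= n < (y ^ 2).+1)
   (\sum_(1 <= a < y.+1) \sum_(1 <= b < y.+1)
     [&& a * b == n, split_only a & split_only b])%N%:R / n%:R.
  rewrite expr2 /split_harmonic big_mkcond mulr_suml.
  under [RHS]eq_bigr => n _ do rewrite natr_sum mulr_suml.
  rewrite exchange_big_nat /=; apply: eq_big_nat => a /andP[a0 ay].
  rewrite mulr_sumr; under [RHS]eq_bigr => n _ do rewrite natr_sum mulr_suml.
  rewrite exchange_big_nat /=; apply: eq_big_nat => b /andP[b0 b_y].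
  pose c : R := (split_only a && split_only b)%:R.
  transitivity (\sum_(1 <= n < (y ^ 2).+1) (a * b == n)%N%:R * (c / n%:R)); last first.
    apply: eq_bigr => n _; rewrite mulrA; congr (_ / _).
    by rewrite /c; case: (_ == _); rewrite ?mul1r ?mul0r.
  rewrite sum_nat_delta ?muln_gt0 ?a0 //.
  have -> : (a * b <= y ^ 2)%N by rewrite -mulnn leq_mul.
  rewrite mul1r natrM invfM /c.
  by case: (split_only a); case: (split_only b); rewrite /= ?mul1r ?mul0r ?mulr0.
apply: ler_sum_nat => n /andP[n0 _]; apply: ler_wpM2r; first by rewrite invr_ge0.
by rewrite pmulrn ler_int; apply: split_pairs_le.
Qed.

(** Abel comparison with the sequence 1, 0, 0, ...: its prefix sums dominate those of [chi8], and
    1/d decreases. *)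
Lemma sum_chi8_inv_le D : \sum_(1 <= d < D.+1) (chi8 d)%:~R / d%:R <= 1 :> R.
Proof.
rewrite big_add1 /= big_mkord.
pose w k : R := k.+1%:R^-1; pose b k : R := (k == 0)%N%:R.
apply: (@le_trans _ _ (\sum_(i < D) b i * w i)).
  apply: (abel_le (a := fun i => (chi8 i.+1)%:~R) (w := w)) => [k||k].
  - by rewrite /w invr_ge0 ler0n lef_pV2 ?posrE ?ltr0n // ler_nat leqnSn.
  - by rewrite /w invr1.
  case: k => [|k]; first by rewrite !big_ord0.
  rewrite -rmorph_sum /= [leRHS]big_ord_recl [X in _ <= _ + X]big1 // addr0 /b eqxx.
  by rewrite -[leRHS]/(1%:~R) ler_int chi8_sum.
case: D => [|D]; first by rewrite big_ord0.
by rewrite big_ord_recl big1 => [|i _]; rewrite /b /w /= ?mul0r // invr1 mul1r addr0.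
Qed.

(** With n = d e, the sum over d <= Y / e is taken innermost, where [sum_chi8_inv_le] bounds it by
    1. *)
Lemma sum_div_chi_le Y :
  \sum_(1 <= n < Y.+1) (div_chi n)%:~R / n%:R <= \sum_(1 <= e < Y.+1) e%:R^-1 :> R.
Proof.
have -> : \sum_(1 <= n < Y.+1) (div_chi n)%:~R / n%:R =
   \sum_(1 <= e < Y.+1) e%:R^-1 * \sum_(1 <= d < (Y %/ e).+1) (chi8 d)%:~R / d%:R :> R.
  transitivity (\sum_(1 <= n < Y.+1) \sum_(1 <= e < Y.+1) \sum_(1 <= d < Y.+1)
      (d * e == n)%N%:R * ((chi8 d)%:~R / (d * e)%N%:R) : R).
    apply: eq_big_nat => n; rewrite ltnS => nY; rewrite (div_chiE nY) exchange_big_nat /=.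
    rewrite rmorph_sum mulr_suml; apply: eq_bigr => e _.
    rewrite rmorph_sum mulr_suml; apply: eq_bigr => d _.
    rewrite rmorphM /= -mulrA natz -pmulrn; case: eqP => [->|]; first by rewrite !mul1r.
    by rewrite !mul0r.
  rewrite exchange_big_nat; apply: eq_big_nat => e /andP[e0 _].
  rewrite exchange_big_nat mulr_sumr /=.
  transitivity (\sum_(1 <= d < Y.+1) (d * e <= Y)%N%:R * ((chi8 d)%:~R / (d * e)%N%:R) : R).
    apply: eq_big_nat => d /andP[d0 _].
    by rewrite (sum_nat_delta _ (fun=> _)) // muln_gt0 d0.
  rewrite (big_cat_nat (n := (Y %/ e).+1)) //=; last by rewrite ltnS leq_div.
  rewrite [X in _ + X]big_nat [X in _ + X]big1 ?addr0; last first.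
    move=> d /andP[dY _]; rewrite -leq_divRL // leqNgt.
    by rewrite dY mul0r.
  apply: eq_big_nat => d /andP[d0 dY]; rewrite -leq_divRL // -ltnS dY mul1r.
  by rewrite natrM invfM mulrA mulrC.
apply: ler_sum_nat => e /andP[e0 _].
by rewrite -[leRHS]mulr1; apply: ler_wpM2l (sum_chi8_inv_le _); rewrite invr_ge0.
Qed.

Lemma harmonic_le_ln Y : (0 < Y)%N -> \sum_(1 <= e < Y.+1) e%:R^-1 <= 1 + ln Y%:R :> R.
Proof.
case: Y => // Y _; elim: Y => [|Y IH]; first by rewrite big_nat1 ln1 invr1 addr0.
rewrite big_nat_recr //=; apply: le_trans (lerD IH (lexx _)) _.
rewrite -addrA lerD2l -lerBrDl -ln_div ?posrE ?ltr0n //.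
rewrite -lerN2 -lnV ?posrE ?divr_gt0 ?ltr0n // invf_div.
have -> : Y.+1%:R / Y.+2%:R = 1 + (- Y.+2%:R^-1) :> R.
  have : Y.+2%:R != 0 :> R by rewrite pnatr_eq0.
  by rewrite -[Y.+2]addn1 natrD => h; field.
by apply: le_ln1Dx; rewrite ltrN2 invf_lt1 ?ltr0n // ltr1n.
Qed.

Lemma ln_nat_ge1 y : (3 < y)%N -> 1 <= ln y%:R :> R.
Proof.
move=> y3.
(* ln (1 + t) <= t at t = -1/2 gives ln 2 >= 1/2, hence ln 4 >= 1. *)
have h : ln (2^-1) <= - 2^-1 :> R.
  have {1}-> : 2^-1 = 1 + - 2^-1 :> R by field.
  by apply: le_ln1Dx; rewrite ltrN2 invf_lt1 ?ltr0n // ltr1n.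
rewrite lnV ?posrE ?ltr0n // lerN2 in h.
have: ln (2 ^+ 2) <= ln y%:R :> R.
  by rewrite ler_ln ?posrE ?exprn_gt0 ?ltr0n //; [rewrite -natrX ler_nat|lia].
by rewrite lnXn ?ltr0n // mulr2n => ?; lra.
Qed.

Lemma split_harmonic_le y : (3 < y)%N -> split_harmonic y <= 2 * Num.sqrt (ln y%:R).
Proof.
move=> y3; have y0 : (0 < y)%N by lia.
have ln1 := ln_nat_ge1 y3.
have H0 : 0 <= split_harmonic y by apply: sumr_ge0 => s _; rewrite invr_ge0.
rewrite -ler_sqr ?nnegrE ?mulr_ge0 ?sqrtr_ge0 // exprMn sqr_sqrtr; last lra.
apply: le_trans (split_harmonic_sqr y) _; apply: le_trans (sum_div_chi_le _) _.
apply: le_trans (harmonic_le_ln _) _; first by rewrite expn_gt0 y0.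
(* 1 + 2 ln y <= 4 ln y = (2 sqrt(ln y))^2. *)
by rewrite natrX lnXn ?ltr0n //; lra.
Qed.
End SplitSums.

(** * Chebyshev's upper bound for psi *)

Section Chebyshev.
Variable R : realType.
Implicit Types (x y n : nat).

Lemma ln_ge0n n : 0 <= ln n%:R :> R.
Proof. by case: n => [|n]; [rewrite ln0|rewrite ln_ge0 // ler1n]. Qed.

Lemma ln_prodn (I : Type) (r : seq I) (P : pred I) (F : I -> nat) :
  (forall i, P i -> (0 < F i)%N) ->
  ln (\prod_(i <- r | P i) F i)%N%:R = \sum_(i <- r | P i) ln (F i)%:R :> R.
Proof.
move=> h; pose K (n : nat) (s : R) := (0 < n)%N /\ ln n%:R = s.
suff: K (\prod_(i <- r | P i) F i)%N (\sum_(i <- r | P i) ln (F i)%:R) by case.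
elim/big_rec2: _ => [|i s n Pi [n0 <-]]; first by split; rewrite ?ln1.
have Fi := h i Pi; split; first by rewrite muln_gt0 Fi.
by rewrite natrM lnM ?posrE ?ltr0n.
Qed.

(** Sum of F against the von Mangoldt function. The pairs p, k <= Y cover all prime powers up to Y;
    on the larger ones the functions F in use vanish. *)
Definition prime_power_sum Y (F : nat -> R) : R :=
  \sum_(1 <= p < Y.+1 | prime p) \sum_(1 <= k < Y.+1) F (p ^ k)%N * ln p%:R.

Lemma logn_sum_dvd p n Y : prime p -> (0 < n <= Y)%N ->
  logn p n = (\sum_(1 <= k < Y.+1) (p ^ k %| n))%N.
Proof.
move=> pp /andP[n0 nY]; rewrite logn_count_dvd // [RHS](big_cat_nat (n := n)) ?leqW //=.
rewrite [X in (_ + X)%N]big_nat [X in (_ + X)%N]big1 ?addn0 // => k /andP[nk _].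
apply/eqP; rewrite eqb0; apply/negP => /(dvdn_leq n0).
by rewrite leqNgt (leq_ltn_trans nk) // ltn_expl // prime_gt1.
Qed.

Lemma ln_prime_powers n Y : (0 < n <= Y)%N ->
  ln n%:R = prime_power_sum Y (fun d => (d %| n)%N%:R).
Proof.
move=> nY; have /andP[n0 leY] := nY.
rewrite -[in LHS](partnT n0) (widen_partn _ leY) ln_prodn; last first.
  by move=> [|p] _; rewrite ?expn_gt0 //  lognE.
rewrite big_ltn // lognE /= expn0 ln1 add0r /prime_power_sum big_mkcond [RHS]big_mkcond.
apply: eq_big_nat => p /andP[p0 _] /=; case: ifP => pp; last by rewrite lognE pp expn0 ln1.
by rewrite natrX lnXn ?ltr0n // (logn_sum_dvd pp nY) -mulr_suml -natr_sum mulr_natl.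
Qed.

Lemma ln_fact n Y : (n <= Y)%N ->
  ln (n`!)%:R = prime_power_sum Y (fun d => (n %/ d)%N%:R).
Proof.
move=> nY; rewrite fact_prod big_nat_cond ln_prodn => [|i /andP[/andP[]] //]; rewrite -big_nat_cond.
rewrite (eq_big_nat _ _ (F2 := fun i => prime_power_sum Y (fun d => (d %| i)%N%:R))); last first.
  by move=> i /andP[i0 ni]; apply: ln_prime_powers; rewrite i0 /= (leq_trans _ nY).
rewrite exchange_big /=; apply: eq_bigr => p pp; rewrite exchange_big /=.
by apply: eq_bigr => k _; rewrite -mulr_suml -natr_sum divn_count_dvd.
Qed.

Lemma ler_prime_power_sum Y F G : (forall d, F d <= G d) ->
  prime_power_sum Y F <= prime_power_sum Y G.
Proof.
move=> h; apply: ler_sum => p _; apply: ler_sum => k _.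
by apply: ler_wpM2r => //; apply: ln_ge0n.
Qed.

Definition psi y : R := prime_power_sum y (fun d => (d <= y)%N%:R).

Lemma psiE y Y : (y <= Y)%N -> prime_power_sum Y (fun d => (d <= y)%N%:R) = psi y.
Proof.
move=> yY; rewrite /psi /prime_power_sum [LHS](big_cat_nat (n := y.+1)) //=.
rewrite [X in _ + X]big_nat_cond [X in _ + X]big1 ?addr0; last first.
  move=> p /andP[/andP[yp _] pp]; rewrite big_nat big1 // => k /andP[k0 _].
  rewrite leqNgt (leq_trans yp) ?mul0r // -{1}(expn1 p) leq_exp2l //.
  exact: prime_gt1.
apply: eq_bigr => p pp; rewrite [LHS](big_cat_nat (n := y.+1)) //=.
rewrite [X in _ + X]big_nat [X in _ + X]big1 ?addr0 // => k /andP[yk _].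
by rewrite leqNgt (ltn_trans yk) ?mul0r // ltn_expl // prime_gt1.
Qed.

(** The indicator of n < d <= 2n is at most floor(2n/d) - 2 floor(n/d). Summed against the von
    Mangoldt function, the latter gives the logarithm of the central binomial coefficient, which is
    at most 2n ln 2. *)
Lemma psi_double n : psi n.*2 - psi n <= n.*2%:R.
Proof.
have n2 : (n <= n.*2)%N by rewrite -addnn leq_addr.
apply: (@le_trans _ _ (ln 'C(n.*2, n)%:R)).
  have -> : ln 'C(n.*2, n)%:R = ln (n.*2`!)%:R - ln (n`!)%:R *+ 2 :> R.
    rewrite -(bin_fact n2) -[X in (X - n)%N]addnn addnK natrM lnM ?posrE ?ltr0n ?bin_gt0 //.
      by rewrite natrM lnM ?posrE ?ltr0n ?fact_gt0 // -mulr2n addrK.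
    by rewrite muln_gt0 !fact_gt0.
  rewrite (ln_fact (leqnn _)) (ln_fact n2) -(psiE n2) -mulr_natl mulr_sumr -!sumrB.
  apply: ler_sum => p pp; rewrite mulr_sumr -!sumrB; apply: ler_sum => k _.
  rewrite mulrA -!mulrBl; apply: ler_wpM2r; first exact: ln_ge0n.
  have : (0 < p ^ k)%N by rewrite expn_gt0 prime_gt0.
  move: (p ^ k)%N => d d0; rewrite -natrM lerBlDr addrAC lerBrDr -!natrD ler_nat.
  case: (leqP d n.*2) => d2; case: (leqP d n) => dn; rewrite /=.
  - by rewrite addnC leq_add2r leq_divRL //; have := leq_trunc_div n d; lia.
  - by rewrite (divn_small dn) muln0 !addn0 divn_gt0.
  - by move: (leq_trans dn n2); rewrite leqNgt d2.
  - by rewrite (divn_small dn) muln0.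
apply: (@le_trans _ _ (ln (2 ^ n.*2)%N%:R)).
  rewrite ler_ln ?posrE ?ltr0n ?bin_gt0 ?expn_gt0 // ler_nat.
  rewrite -[2%N]/(1 + 1)%N expnDn (bigD1 (Ordinal (n2 : (n < n.*2.+1)%N))) //=.
  by rewrite !exp1n !muln1 leq_addr.
rewrite natrX lnXn ?ltr0n // -[leLHS]mulr_natl -[leRHS]mulr1; apply: ler_wpM2l => //.
have -> : 2%:R = 1 + 1 :> R by [].
by apply: le_ln1Dx; lra.
Qed.

Lemma psi_homo m n : (m <= n)%N -> psi m <= psi n.
Proof.
move=> mn; rewrite -(psiE mn); apply: ler_prime_power_sum => d.
by rewrite ler_nat; case: (leqP d m) => // dm; rewrite (leq_trans dm mn).
Qed.

(** Halving with h = [uphalf y]: psi(2h) <= 2h + 4h <= 4y for y >= 2, with equality in the last step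
    at y = 3. *)
Lemma psi_le y : psi y <= 4 * y%:R.
Proof.
elim/ltn_ind: y => y IH; have [y1|y1] := leqP y 1.
  rewrite /psi /prime_power_sum big_nat_cond big1 ?mulr_ge0 // => p /andP[/andP[p1 py] pp].
  by have := prime_gt1 pp; lia.
have yn : (y <= (uphalf y).*2)%N by lia.
apply: le_trans (psi_homo yn) _.
have := psi_double (uphalf y); rewrite lerBlDr => /le_trans -> //.
have [y2|y2] := eqVneq y 2%N.
  by have := IH 1%N; rewrite y2 -[(uphalf 2).*2]/2%N -[uphalf 2]/1%N => /(_ isT) h; lra.
have uy : (uphalf y < y)%N by lia.
apply: le_trans (lerD (lexx _) (IH _ uy)) _.
by rewrite -!natrM -natrD ler_nat; lia.
Qed.
End Chebyshev.

(** * Logarithmic sums over split numbers *)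

Section SplitLogs.
Variable R : realType.
Implicit Types (x y n : nat).
Local Notation H := (@split_harmonic R).

Lemma lnS_le n : (0 < n)%N -> ln n.+1%:R <= ln n%:R + n%:R^-1 :> R.
Proof.
move=> n0; rewrite addrC -lerBlDr -ln_div ?posrE ?ltr0n //.
have -> : n.+1%:R / n%:R = 1 + n%:R^-1 :> R.
  have : n%:R != 0 :> R by rewrite pnatr_eq0 -lt0n.
  by rewrite -[n.+1]addn1 natrD => h; field.
by apply: le_ln1Dx; apply: lt_trans (_ : 0 < _); rewrite ?ltrN10 // invr_gt0 ltr0n.
Qed.

Lemma natr_div_le m d : (m %/ d)%N%:R <= m%:R / d%:R :> R.
Proof.
case: d => [|d]; first by rewrite divn0 invr0 mulr0.
by rewrite ler_pdivlMr ?ltr0n // -natrM ler_nat leq_trunc_div.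
Qed.

Lemma split_harmonic_homo m n : (m <= n)%N -> H m <= H n.
Proof.
move=> mn; rewrite /split_harmonic [leRHS](big_cat_nat (n := m.+1)) //= lerDl.
by apply: sumr_ge0 => s _; rewrite invr_ge0.
Qed.

(** Write ln s as a sum over prime powers d dividing s = d m. The cofactor m is again split; keeping
    only this condition leaves the sum of psi(y / m) over split m, where psi(t) <= 4t produces H. *)
Lemma split_ln_sum y :
  \sum_(1 <= s < y.+1 | split_only s) ln s%:R <= 4 * y%:R * H y.
Proof.
have -> : \sum_(1 <= s < y.+1 | split_only s) ln s%:R =
    prime_power_sum y (fun d => \sum_(1 <= s < y.+1) (split_only s && (d %| s)%N)%:R : R).
  transitivity (\sum_(1 <= s < y.+1)
     prime_power_sum y (fun d => ((split_only s && (d %| s)%N)%:R : R))).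
    rewrite big_mkcond; apply: eq_big_nat => s /andP[s0 sy]; case: ifP => ss /=.
      by apply: ln_prime_powers; rewrite s0.
    by rewrite /prime_power_sum big1 // => p _; rewrite big1 // => k _; rewrite mul0r.
  rewrite exchange_big /=; apply: eq_bigr => p _; rewrite exchange_big /=.
  by apply: eq_bigr => k _; rewrite mulr_suml.
apply: (@le_trans _ _ (prime_power_sum y (fun d =>
   \sum_(1 <= m < y.+1 | split_only m) ((d <= y %/ m)%N%:R : R)))).
  apply: ler_sum => p pp; apply: ler_sum => k _.
  apply: ler_wpM2r; first exact: ln_ge0n.
  have : (0 < p ^ k)%N by rewrite expn_gt0 prime_gt0.
  move: (p ^ k)%N => d d0.
  apply: (@le_trans _ _ (\sum_(1 <= s < y.+1) \sum_(1 <= m < y.+1)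
     (d * m == s)%N%:R * (split_only m)%:R)).
    apply: ler_sum_nat => s /andP[s0 sy]; case: (boolP (d %| s)%N) => [|_]; last first.
      by rewrite andbF; apply: sumr_ge0 => m _; rewrite mulr_ge0.
    case/dvdnP => m E; case: (boolP (split_only s)) => ss; last first.
      by apply: sumr_ge0 => i _; rewrite mulr_ge0.
    have m0 : (0 < m)%N by move: s0; rewrite E muln_gt0 => /andP[].
    have my : (m <= y)%N by apply: leq_trans (sy : s <= y)%N; rewrite E leq_pmulr.
    rewrite (bigD1_seq m) ?iota_uniq ?mem_index_iota ?m0 ?ltnS //=.
    rewrite [(d * m)%N]mulnC -E eqxx.
    rewrite (_ : split_only m) ?mulr1 ?lerDl; first by apply: sumr_ge0 => i _; rewrite mulr_ge0.
    by apply: split_only_dvd ss => //; rewrite E dvdn_mulr.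
  rewrite exchange_big_nat /= [leRHS]big_mkcond; apply: ler_sum_nat => m /andP[m0 my].
  rewrite (sum_nat_delta _ (fun=> _)) ?muln_gt0 ?d0 //.
  by rewrite leq_divRL //; case: ifP => _; rewrite ?mulr1 ?mulr0.
have -> : prime_power_sum y (fun d => \sum_(1 <= m < y.+1 | split_only m) ((d <= y %/ m)%N%:R : R))
   = \sum_(1 <= m < y.+1 | split_only m) psi R (y %/ m).
  transitivity (\sum_(1 <= m < y.+1 | split_only m)
     prime_power_sum y (fun d => ((d <= y %/ m)%N%:R : R))).
    rewrite [RHS]exchange_big /=; apply: eq_bigr => p _; rewrite [RHS]exchange_big /=.
    by apply: eq_bigr => k _; rewrite mulr_suml.
  by apply: eq_bigr => m _; rewrite psiE // leq_div.
rewrite mulr_sumr; apply: ler_sum => m _.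
apply: le_trans (psi_le _ _) _; rewrite -mulrA ler_pM2l //.
exact: natr_div_le.
Qed.

(** ln (d s) = ln d + ln s. For ln d the trivial count x / d suffices, because ln d / d has a
    bounded sum over the values d = 2^e g^2 to come. *)
Lemma split_multiples_ln d x : (0 < d)%N ->
  \sum_(1 <= s < x.+1 | split_only s) (d * s <= x)%N%:R * ln (d * s)%N%:R
  <= x%:R / d%:R * (ln d%:R + 4 * H x).
Proof.
move=> d0; rewrite (big_cat_nat (n := (x %/ d).+1)) //=; last by rewrite ltnS leq_div.
rewrite [X in _ + X]big_nat_cond [X in _ + X]big1 ?addr0; last first.
  move=> s /andP[/andP[xs _] _]; rewrite mulnC -leq_divRL // leqNgt.
  by rewrite xs mul0r.
apply: (@le_trans _ _ (\sum_(1 <= s < (x %/ d).+1 | split_only s) (ln d%:R + ln s%:R))).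
  rewrite big_nat_cond [leRHS]big_nat_cond; apply: ler_sum => s /andP[/andP[s0 sx] _].
  rewrite mulnC -leq_divRL // -ltnS sx mul1r natrM lnM ?posrE ?ltr0n //.
  by rewrite addrC.
rewrite big_split /= mulrDr lerD //.
  apply: (@le_trans _ _ (\sum_(1 <= s < (x %/ d).+1) ln d%:R)).
    rewrite [leLHS]big_mkcond; apply: ler_sum => s _; case: ifP => // _.
    exact: ln_ge0n.
  rewrite sumr_const_nat subn1 /= -[leLHS]mulr_natl.
  by apply: ler_wpM2r; [exact: ln_ge0n|exact: natr_div_le].
apply: le_trans (split_ln_sum _) _; rewrite mulrCA -mulrA ler_pM2l //.
apply: ler_pM => //; last by apply: split_harmonic_homo; rewrite leq_div.
- by apply: sumr_ge0 => s _; rewrite invr_ge0.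
- exact: natr_div_le.
Qed.

Lemma sum_ln_inv_sqr G : \sum_(1 <= g < G.+1) (ln g%:R + 1) / g%:R ^+ 2 <= 4 :> R.
Proof.
(* (ln t + 2) / t has derivative -(ln t + 1) / t^2. The factor 2 pays for the discrete step, as g +
   1 <= 2g, and 4 = 2 f(1). *)
pose f g : R := (ln g%:R + 2) / g%:R.
suff: \sum_(1 <= g < G.+1) (ln g%:R + 1) / g%:R ^+ 2 <= 2 * (f 1%N - f G.+1).
  have : 0 <= f G.+1 by rewrite divr_ge0 // addr_ge0 // ln_ge0n.
  have -> : f 1%N = 2 by rewrite /f ln1 add0r divr1.
  by move=> f0 h; apply: le_trans h _; lra.
elim: G => [|G IH]; first by rewrite big_geq // subrr mulr0.
rewrite big_nat_recr //=; apply: le_trans (lerD IH (lexx _)) _.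
have step (a b c t : R) : t <= 2 * (b - c) -> 2 * (a - b) + t <= 2 * (a - c) by lra.
apply: step.
rewrite /f.
have l := lnS_le (ltn0Sn G).
have L0 : 0 <= ln G.+1%:R :> R := ln_ge0n _ _.
have g1 : 1 <= G.+1%:R :> R by rewrite ler1n.
have E : G.+2%:R = G.+1%:R + 1 :> R by rewrite -[G.+2]addn1 natrD.
suff key (L2 L g : R) : L2 <= L + g^-1 -> 0 <= L -> 1 <= g ->
    (L + 1) / g ^+ 2 <= 2 * ((L + 2) / g - (L2 + 2) / (g + 1)).
  by rewrite [in X in _ - X / _]E [in X in _ - _ / X]E; apply: key => //; rewrite -E.
move=> {}l {}L0 {}g1.
apply: (@le_trans _ _ (2 * ((L + 2) / g - (L + g^-1 + 2) / (g + 1)))); last first.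
  rewrite ler_pM2l // lerD2l lerN2; apply: ler_wpM2r; last by rewrite lerD2r.
  by rewrite invr_ge0; lra.
have -> : 2 * ((L + 2) / g - (L + g^-1 + 2) / (g + 1)) = 2 * (L + 1) / (g * (g + 1)).
  by field; apply/andP; split; lra.
rewrite ler_pdivrMr; last by rewrite exprn_gt0; lra.
rewrite mulrAC ler_pdivlMr; last by rewrite mulr_gt0; lra.
rewrite -subr_ge0.
have -> : 2 * (L + 1) * g ^+ 2 - (L + 1) * (g * (g + 1)) = (L + 1) * g * (g - 1) by ring.
by rewrite !mulr_ge0 //; lra.
Qed.
End SplitLogs.

(** * Norms up to x *)

Section NormCount.
Variable R : realType.
Implicit Types (x y n : nat).
Local Notation H := (@split_harmonic R).

(** The cost of replacing ln n by ln x. The induction step adds x ln(1 + 1/x) <= 1. *)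
Lemma sum_ln_gap_le x : \sum_(1 <= n < x.+1) (ln x%:R - ln n%:R) <= x%:R :> R.
Proof.
elim: x => [|x IH]; first by rewrite big_geq.
rewrite big_nat_recr //= subrr addr0.
have -> : \sum_(1 <= n < x.+1) (ln x.+1%:R - ln n%:R) =
   \sum_(1 <= n < x.+1) (ln x%:R - ln n%:R) + x%:R * (ln x.+1%:R - ln x%:R) :> R.
  rewrite [X in _ + X](_ : _ = \sum_(1 <= n < x.+1) (ln x.+1%:R - ln x%:R)); last first.
    by rewrite sumr_const_nat subn1 mulr_natl.
  by rewrite -big_split; apply: eq_bigr => n _ /=; ring.
rewrite -[x.+1 in leRHS]addn1 natrD lerD //.
have [->|x0] := posnP x; first by rewrite mul0r.
have xp : 0 < x%:R :> R by rewrite ltr0n.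
rewrite -[leRHS](mulfV (lt0r_neq0 xp)) ler_pM2l // lerBlDl.
exact: lnS_le.
Qed.

(** The constants come from 2 * 4 * (2 + 4 H): two values of e, the bound 4 for the sum over g, and
    1 + 2 ln g + 4 H <= (2 + 4 H)(ln g + 1). *)
Lemma norm_ln_sum (P : pred nat) x :
  (forall n, (0 < n)%N -> P n -> exists u v, (n + 2 * v ^ 2 = u ^ 2)%N) ->
  \sum_(1 <= n < x.+1) (P n)%:R * ln n%:R <= x%:R * (16 + 32 * H x).
Proof.
move=> hP.
have H0 : 0 <= H x by apply: sumr_ge0 => s _; rewrite invr_ge0.
(* Every n in [P] is hit by some triple of [norm_decomp]; repeated or extra triples only increase
   the sum, all terms being nonnegative. *)
apply: (@le_trans _ _ (\sum_(e < 2) \sum_(1 <= g < x.+1) \sum_(1 <= s < x.+1 | split_only s)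
   (2 ^ e * g ^ 2 * s <= x)%N%:R * ln (2 ^ e * g ^ 2 * s)%N%:R)).
  apply: (@le_trans _ _ (\sum_(1 <= n < x.+1) \sum_(e < 2) \sum_(1 <= g < x.+1)
     \sum_(1 <= s < x.+1 | split_only s) (2 ^ e * g ^ 2 * s == n)%N%:R * ln n%:R)).
    apply: ler_sum_nat => n /andP[n0 nx].
    have t0 (k : nat) : 0 <= (k == n)%:R * ln n%:R :> R by rewrite mulr_ge0 // ln_ge0n.
    case: (boolP (P n)) => Pn; last first.
      by rewrite mul0r; do 3?(apply: sumr_ge0 => ? _).
    have [u [v Euv]] := hP n n0 Pn.
    have [e [g [s [e2 g0 s0 ss E]]]] := norm_decomp n0 Euv.
    have p2 : (0 < 2 ^ e)%N by rewrite expn_gt0.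
    have gx : (g < x.+1)%N.
      apply: leq_trans nx; rewrite ltnS E -mulnA mulnCA -mulnn -mulnA leq_pmulr //.
      by rewrite !muln_gt0 g0 p2.
    have sx : (s < x.+1)%N.
      by apply: leq_trans nx; rewrite ltnS E leq_pmull // muln_gt0 p2 expn_gt0 g0.
    rewrite (bigD1 (Ordinal e2)) //= (bigD1_seq g) ?iota_uniq ?mem_index_iota ?g0 //=.
    rewrite -big_filter (bigD1_seq s) ?filter_uniq ?iota_uniq ?mem_filter ?mem_index_iota ?ss ?s0 //=.
    rewrite -E eqxx -!addrA lerDl !addr_ge0 //.
    - by apply: sumr_ge0 => ? _.
    - by do 2?(apply: sumr_ge0 => ? _).
    - by do 3?(apply: sumr_ge0 => ? _).
  rewrite exchange_big /=; apply: ler_sum => e _.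
  rewrite exchange_big_nat /=; apply: ler_sum_nat => g /andP[g0 _].
  rewrite exchange_big /= big_nat_cond [leRHS]big_nat_cond.
  apply: ler_sum => s /andP[/andP[s0 _] _].
  by rewrite (sum_nat_delta _ (fun n => ln n%:R)) // !muln_gt0 !expn_gt0 g0.
have bound (e : 'I_2) g : (0 < g)%N -> \sum_(1 <= s < x.+1 | split_only s)
   (2 ^ e * g ^ 2 * s <= x)%N%:R * ln (2 ^ e * g ^ 2 * s)%N%:R
   <= x%:R * (2 + 4 * H x) * ((ln g%:R + 1) / g%:R ^+ 2) :> R.
  move=> g0; have d0 : (0 < 2 ^ e * g ^ 2)%N by rewrite muln_gt0 !expn_gt0 g0.
  apply: le_trans (split_multiples_ln R x d0) _.
  rewrite -!mulrA ler_wpM2l //.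
  have gp : 0 < g%:R ^+ 2 :> R by rewrite exprn_gt0 // ltr0n.
  have L0 : 0 <= ln g%:R :> R by apply: ln_ge0n.
  rewrite [leRHS]mulrA [leRHS]mulrC; apply: ler_pM.
  - by rewrite invr_ge0.
  - by rewrite addr_ge0 ?mulr_ge0 // ln_ge0n.
  - by rewrite lef_pV2 ?posrE ?ltr0n // -natrX ler_nat leq_pmull // expn_gt0.
  have ld : ln (2 ^ e * g ^ 2)%N%:R <= 1 + 2 * ln g%:R :> R.
    rewrite natrM lnM ?posrE ?ltr0n ?expn_gt0 ?g0 // !natrX !lnXn ?ltr0n //.
    rewrite -(mulr_natl (ln g%:R)) lerD2r.
    have l2 : ln 2%:R <= 1 :> R by have := @le_ln1Dx R 1; apply; lra.
    have l20 : 0 <= ln 2%:R :> R by apply: ln_ge0n.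
    by case: (e) => -[|[|//]] /=.
  apply: le_trans (lerD ld (lexx _)) _.
  by have := mulr_ge0 H0 L0; lra.
apply: (@le_trans _ _ (\sum_(e < 2) x%:R * (2 + 4 * H x) * 4)).
  apply: ler_sum => e _.
  apply: (@le_trans _ _ (\sum_(1 <= g < x.+1) x%:R * (2 + 4 * H x) * ((ln g%:R + 1) / g%:R ^+ 2))).
    by apply: ler_sum_nat => g /andP[g0 _]; apply: bound.
  rewrite -mulr_sumr; apply: ler_wpM2l; last exact: sum_ln_inv_sqr.
  by rewrite mulr_ge0 // addr_ge0 // mulr_ge0.
rewrite sumr_const card_ord -[leLHS]mulr_natl; lra.
Qed.

(** Multiplied by ln x = L^2, the count is at most x (16 + 32 H) + x, with H <= 2 L; and 17 + 64 L
    <= 81 L because L >= 1. *)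
Lemma norm_count (P : pred nat) x :
  (forall n, (0 < n)%N -> P n -> exists u v, (n + 2 * v ^ 2 = u ^ 2)%N) ->
  (3 < x)%N ->
  \sum_(1 <= n < x.+1) (P n)%:R <= 81 * x%:R / Num.sqrt (ln x%:R) :> R.
Proof.
move=> hP x3; set L := Num.sqrt _.
have l1 := ln_nat_ge1 R x3.
have EL : ln x%:R = L ^+ 2 by rewrite sqr_sqrtr //; lra.
have L1 : 1 <= L by rewrite -ler_sqr ?nnegrE ?sqrtr_ge0 // -EL expr1n.
have L0 : 0 < L by lra.
rewrite ler_pdivlMr // -(ler_pM2r L0) -mulrA -expr2 -EL mulr_suml.
apply: (@le_trans _ _ (\sum_(1 <= n < x.+1) (P n)%:R * ln n%:R +
   \sum_(1 <= n < x.+1) (ln x%:R - ln n%:R))).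
  rewrite -big_split /=; apply: ler_sum_nat => n /andP[n0 nx].
  have : ln n%:R <= ln x%:R :> R by rewrite ler_ln ?posrE ?ltr0n ?ler_nat //; lia.
  by case: (P n) => h /=; rewrite ?mul1r ?mul0r; lra.
apply: le_trans (lerD (norm_ln_sum x hP) (sum_ln_gap_le x)) _.
have h := split_harmonic_le R x3; rewrite -/L in h.
have x0 : 0 <= x%:R :> R by [].
apply: (@le_trans _ _ (x%:R * (16 + 64 * L) + x%:R)).
  by rewrite lerD2r ler_wpM2l //; lra.
have -> : x%:R * (16 + 64 * L) + x%:R = x%:R * (17 + 64 * L) by ring.
by rewrite [81 * _]mulrC -mulrA ler_wpM2l //; lra.
Qed.
End NormCount.

(** * The two bounds *)

(** The bound alpha + beta n is the prefix sum of alpha + beta, beta, beta, ..., so Abel comparison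
    with the decreasing weights z^k reduces to a geometric series. *)
Lemma power_sum_le (R : realType) (a : nat -> R) (alpha beta z : R) N :
  (forall n, \sum_(1 <= k < n.+1) a k <= alpha + beta * n%:R) ->
  0 <= alpha -> 0 <= beta -> 0 < z < 1 ->
  \sum_(1 <= k < N) a k * z ^+ k <= alpha + beta / (1 - z).
Proof.
move=> ha al0 be0 /andP[z0 z1].
have z1' : 0 < 1 - z by lra.
case: N => [|N].
  by rewrite big_geq // addr_ge0 // divr_ge0 // ltW.
rewrite big_add1 /= big_mkord.
pose w k := z ^+ k.+1; pose b k : R := (k == 0)%N%:R * alpha + beta.
apply: (@le_trans _ _ (\sum_(i < N) b i * w i)).
  apply: (abel_le (a := fun k => a k.+1) (w := w)) => [k||k].
  - rewrite /w exprn_ge0 ?(ltW z0) //= exprS -[leRHS]mul1r.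
    by apply: ler_wpM2r (ltW z1); rewrite exprn_ge0 // ltW.
  - by rewrite /w expr1 ltW.
  - case: k => [|k]; first by rewrite !big_ord0.
    have := ha k.+1; rewrite big_add1 /= big_mkord => /le_trans; apply.
    rewrite /b big_split /= sumr_const card_ord -mulr_suml -[X in _ <= _ + X]mulr_natr.
    rewrite big_ord_recl big1 //= addr0 mul1r lerD //.
have -> : \sum_(i < N) b i * w i = \sum_(i < N) (i == 0 :> nat)%:R * (alpha * w i)
    + beta * \sum_(i < N) w i.
  by rewrite mulr_sumr -big_split; apply: eq_bigr => i _; rewrite /b /=; ring.
apply: lerD.
  case: N => [|N]; first by rewrite big_ord0.
  rewrite big_ord_recl big1 ?addr0 => [|i _]; last by rewrite mul0r.
  by rewrite mul1r -[leRHS]mulr1 ler_wpM2l // /w expr1 ltW.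
apply: ler_wpM2l => //; rewrite -[leRHS]mul1r ler_pdivlMr //.
suff -> : (\sum_(i < N) w i) * (1 - z) = z * (1 - z ^+ N).
  have := exprn_gt0 N z0; rewrite mulrBr mulr1 => h.
  have := mulr_gt0 z0 h; lra.
rewrite /w; elim: N => [|N IH]; first by rewrite big_ord0 mul0r subrr mulr0.
by rewrite big_ord_recr /= mulrDl IH !exprS; ring.
Qed.

Lemma cvg_abs_sum (R : realType) (u : nat -> R) M :
  (forall N, \sum_(1 <= n < N) `|u n| <= M) ->
  cvgn (fun N => \sum_(1 <= n < N) u n) /\
  `|limn (fun N => \sum_(1 <= n < N) u n)| <= M.
Proof.
move=> hM.
have c : cvgn (fun N => \sum_(1 <= n < N) u n).
  (* [series] starts at index 0, so the sequence is extended by 0 there. *)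
  pose v n := if n is 0 then 0 else u n.
  have E (f : nat -> R) : f 0%N = 0 ->
     (fun N => \sum_(1 <= n < N) f n) = series f.
    move=> f0; apply/funext => -[|N]; rewrite /series /=; first by rewrite !big_geq.
    by rewrite [RHS]big_ltn // f0 add0r.
  have -> : (fun N => \sum_(1 <= n < N) u n) = series v.
    rewrite -E //; apply/funext => N; apply: eq_big_nat => -[|n] //.
  apply: normed_cvg.
  have <- : (fun N => \sum_(1 <= n < N) `|v n|) = [normed series v].
    by rewrite (E (fun n => `|v n|)) // normr0.
  apply: nondecreasing_is_cvgn.
    apply/nondecreasing_seqP => N; case: N => [|N]; first by rewrite !big_geq.
    by rewrite [leRHS]big_nat_recr //= lerDl.
  exists M => _ [N _ <-]; apply: le_trans (hM N).
  by apply: ler_sum_nat => -[|n].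
split=> //; rewrite ler_norml; apply/andP; split.
  apply: limr_ge => //; apply: nearW => N.
  rewrite lerNl; apply: le_trans (hM N).
  apply: le_trans (ler_norm _) _; rewrite normrN; exact: ler_norm_sum.
apply: limr_le => //; apply: nearW => N.
apply: le_trans (hM N); apply: le_trans (ler_norm _) _; exact: ler_norm_sum.
Qed.

Lemma p1_series_bound (R : realType) (z : R) N : 0 < z < 1 ->
  \sum_(1 <= n < N) `|(p1 n)%:~R * z ^+ n| <= 2 / (1 - z).
Proof.
move=> z01; have /andP[z0 z1] := z01.
rewrite -[leRHS]add0r.
have -> : \sum_(1 <= n < N) `|(p1 n)%:~R * z ^+ n| =
   \sum_(1 <= n < N) (`|p1 n|%N%:R : R) * z ^+ n.
  apply: eq_bigr => n _; rewrite normrM [`|z ^+ n|]ger0_norm ?exprn_ge0 ?(ltW z0) //.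
  by rewrite -intr_norm pmulrn abszE.
apply: power_sum_le => // n; rewrite add0r -natr_sum -natrM ler_nat.
apply: leq_trans (sum_absz_p1 n).
by rewrite -(big_mkord xpredT (fun n => `|p1 n|%N)) [leqRHS]big_ltn // leq_addl.
Qed.

(** [power_sum_le] needs a slope independent of n. Up to sqrt T the trivial count serves; beyond it
    ln n >= ln T / 2, which costs at most a factor 2 in 81. T >= 16 puts such n above 3. *)
Lemma pos_p1_count_le (R : realType) (T : R) n : 16 <= T ->
  \sum_(1 <= k < n.+1) (0 < p1 k)%R%:R <= Num.sqrt T + 162 / Num.sqrt (ln T) * n%:R.
Proof.
move=> T16; have T0 : 0 < T by lra.
have lT : 0 < ln T by rewrite ln_gt0; lra.
have sT : 0 < Num.sqrt (ln T) by rewrite sqrtr_gt0.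
have q0 : 0 <= Num.sqrt T by apply: sqrtr_ge0.
have qT : Num.sqrt T ^+ 2 = T by rewrite sqr_sqrtr // ltW.
have q4 : 4 <= Num.sqrt T by rewrite -ler_sqr ?nnegrE // qT; lra.
have r0 : 0 <= 162 / Num.sqrt (ln T) * n%:R by rewrite mulr_ge0 // divr_ge0 // ltW.
have [nT|nT] := leP (n%:R) (Num.sqrt T).
  apply: (@le_trans _ _ n%:R); last lra.
  have -> : n%:R = \sum_(1 <= k < n.+1) 1 :> R by rewrite sumr_const_nat subn1.
  by apply: ler_sum_nat => k _; case: (0 < p1 k).
have n3 : (3 < n)%N by rewrite -(ltr_nat R); lra.
apply: le_trans (norm_count R (P := fun k => 0 < p1 k) _ n3) _.
  move=> k k0 pk; have [|u [v [_ E]]] := p1_neq0_norm (n := k); first by rewrite gt_eqF.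
  by exists u, v.
apply: (@le_trans _ _ (162 / Num.sqrt (ln T) * n%:R)); last lra.
have -> : 162 / Num.sqrt (ln T) * n%:R = 81 * n%:R / (Num.sqrt (ln T) / 2).
  by field; lra.
have n0 : 0 < n%:R :> R by lra.
apply: ler_wpM2l; first by rewrite mulr_ge0 // ltW.
have h : Num.sqrt (ln T) / 2 <= Num.sqrt (ln n%:R).
  have ln1 := ln_nat_ge1 R n3.
  rewrite -ler_sqr ?nnegrE ?sqrtr_ge0 ?divr_ge0 ?sqrtr_ge0 // exprMn sqr_sqrtr ?(ltW lT) //.
  rewrite sqr_sqrtr; last lra.
  have : ln T <= ln (n%:R ^+ 2).
    rewrite ler_ln ?posrE ?exprn_gt0 // -qT ler_sqr ?nnegrE ?(ltW nT) ?(ltW n0) //.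
  rewrite lnXn // -(mulr_natl (ln n%:R)) exprVn => ?; lra.
by rewrite lef_pV2 ?posrE ?sqrtr_gt0 ?divr_gt0 //; have := ln_nat_ge1 R n3; lra.
Qed.

(** With T = 1 / (1 - z), z > 15/16 gives T >= 16. The term sqrt T is at most T / sqrt(ln T) since
    ln T <= T, whence 163 = 162 + 1. *)
Lemma pos_p1_series_bound (R : realType) (z : R) N : 15 / 16 < z < 1 ->
  \sum_(1 <= n < N) `|(0 < p1 n)%R%:R * z ^+ n| <=
  163 * (1 / ((1 - z) * Num.sqrt (ln (1 / (1 - z))))).
Proof.
move=> /andP[z0 z1].
pose T := 1 / (1 - z).
have T16 : 16 <= T by rewrite /T ler_pdivlMr; lra.
have T0 : 0 < T by lra.
have lT : 0 < ln T by rewrite ln_gt0; lra.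
have sT : 0 < Num.sqrt (ln T) by rewrite sqrtr_gt0.
have -> : \sum_(1 <= n < N) `|(0 < p1 n)%R%:R * z ^+ n| =
   \sum_(1 <= n < N) (0 < p1 n)%R%:R * z ^+ n.
  by apply: eq_bigr => n _; rewrite ger0_norm // mulr_ge0 // exprn_ge0; lra.
apply: le_trans (@power_sum_le _ _ (Num.sqrt T) (162 / Num.sqrt (ln T)) z N _ _ _ _) _.
- by move=> n; apply: pos_p1_count_le.
- exact: sqrtr_ge0.
- by rewrite divr_ge0 // ltW.
- by apply/andP; split; lra.
rewrite -/T.
have -> : 1 / ((1 - z) * Num.sqrt (ln T)) = T / Num.sqrt (ln T).
  by rewrite /T invfM mulrA.
have -> : 162 / Num.sqrt (ln T) / (1 - z) = 162 * (T / Num.sqrt (ln T)).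
  by rewrite /T mul1r -!mulrA [in LHS](mulrC (_^-1)).
suff : Num.sqrt T <= T / Num.sqrt (ln T) by lra.
rewrite ler_pdivlMr // -[leRHS](sqr_sqrtr (ltW T0)) expr2; apply: ler_wpM2l; rewrite ?sqrtr_ge0 //.
by rewrite ler_wsqrtr // ltW // ln_sublinear.
Qed.

(** An infinite sum is a limit and takes a default value when the partial sums diverge; the
    convergence clauses therefore accompany the two bounds. *)
Theorem theorem1p2 (R : realType) :
  [/\ (\forall z \near (1 : R)^'-,
         cvgn (fun N => \sum_(1 <= n < N) (p1 n)%:~R * z ^+ n : R)),
      (fun z : R => \big[+%R/0]_(1 <= n <oo) ((p1 n)%:~R * z ^+ n) : R)
        =O_ ((1 : R)^'-) (fun z : R => 1 / (1 - z) : R),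
      (\forall z \near (1 : R)^'-,
         cvgn (fun N => \sum_(1 <= n < N | 0 < p1 n) z ^+ n : R)) &
      (fun z : R => \big[+%R/0]_(1 <= n <oo | 0 < p1 n) (z ^+ n) : R)
        =O_ ((1 : R)^'-)
        (fun z : R => 1 / ((1 - z) * Num.sqrt (ln (1 / (1 - z)))) : R)].
Proof.
have near1 : \forall z \near (1 : R)^'-, 15 / 16 < z < 1.
  near=> z; apply/andP; split.
    by near: z; apply: nbhs_left_gt; lra.
  by near: z; apply: nbhs_left_lt.
have E (z : R) : (fun N => \sum_(1 <= n < N | 0 < p1 n) z ^+ n) =
    (fun N => \sum_(1 <= n < N) (0 < p1 n)%R%:R * z ^+ n).
  apply/funext => N; rewrite big_mkcond; apply: eq_bigr => n _.
  by case: ifP => _; rewrite ?mul1r ?mul0r.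
have A (z : R) : 15 / 16 < z < 1 -> 0 < z < 1 by move=> /andP[? ?]; apply/andP; split; lra.
split.
- apply: filterS near1 => z /A z01.
  by have [] := cvg_abs_sum (fun N => p1_series_bound N z01).
- apply/eqO_exP; exists 2 => //; apply: filterS near1 => z /A z01.
  have [_] := cvg_abs_sum (fun N => p1_series_bound N z01).
  move=> /le_trans; apply; have /andP[z0 z1] := z01.
  by rewrite ger0_norm ?mul1r // invr_ge0; lra.
- apply: filterS near1 => z z01; rewrite E.
  by have [] := cvg_abs_sum (fun N => pos_p1_series_bound N z01).
apply/eqO_exP; exists 163 => //; apply: filterS near1 => z z01.
rewrite E; have [_] := cvg_abs_sum (fun N => pos_p1_series_bound N z01).
move=> /le_trans; apply; rewrite ler_pM2l //; exact: ler_norm.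
Unshelve. all: by end_near.
Qed.
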